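(* Let $\Omega\subseteq\mathbb{R}^N$ be an open set, $s\in(0,1)$, $p\in(1,\infty)$. Let $c\in C(\overline{\Omega})$ be a non-positive function and let $u\in\mathcal{W}^{s,p}(\Omega)\cap C(\overline{\Omega})$ be a weak super-solution of $(-\Delta_p)^s u=c(x)|u|^{p-2}u$ in $\Omega$. (1) If $\Omega$ is bounded and $u\ge 0$ a.e. in $\Omega^c$, then either $u>0$ in $\Omega$ or $u=0$ a.e. in $\mathbb{R}^N$. (2) If $u\ge0$ a.e. in $\mathbb{R}^N$, then either $u>0$ in $\Omega$ or $u=0$ a.e. in $\mathbb{R}^N$.
   Context: Notation: $A^c=\mathbb{R}^N\setminus A$; $|t|^{p-2}t:=0$ for $t=0$. For an open set $U\subseteq\mathbb{R}^N$, $W^{s,p}(U)$ is the set of $u\in L^p(U)$ with $\int_{U\times U}\frac{|u(x)-u(y)|^p}{|x-y|^{N+sp}}\,dx\,dy<\infty$, normed by the $p$-th root of $\|u\|_{L^p(U)}^p$ plus this integral. $\widetilde{W}^{s,p}(\Omega)$ is the space of all $u\in W^{s,p}(\Omega)$ whose extension by zero to $\mathbb{R}^N$ belongs to $W^{s,p}(\mathbb{R}^N)$ (elements are identified with their zero extensions); $W^{-s,p'}(\Omega)$ is its dual, with pairing $\langle\cdot,\cdot\rangle$; a function $f$ on $\Omega$ is identified with the functional $\varphi\mapsto\int_\Omega f\varphi\,dx$. $\mathcal{W}^{s,p}(\Omega)$ is the space of all $u\in L^p_{loc}(\mathbb{R}^N)$ such that for every bounded $\Omega'\subseteq\Omega$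 there is an open set $U\supset\supset\Omega'$ with $u\in W^{s,p}(U)$, and $\int_{\mathbb{R}^N}\frac{|u(x)|^{p-1}}{(1+|x|)^{N+sp}}\,dx<\infty$. Weak super-solutions: let $f\in W^{-s,p'}(\Omega)$. If $\Omega$ is bounded, $u\in\mathcal{W}^{s,p}(\Omega)$ is a weak super-solution of $(-\Delta_p)^su=f$ in $\Omega$ if for every $\varphi\in\widetilde{W}^{s,p}(\Omega)$, $\varphi\ge0$, $$\int_{\mathbb{R}^{2N}}\frac{|u(x)-u(y)|^{p-2}(u(x)-u(y))(\varphi(x)-\varphi(y))}{|x-y|^{N+sp}}\,dx\,dy\ \ge\ \langle f,\varphi\rangle .$$ If $\Omega$ is unbounded, $u\in\mathcal{W}^{s,p}(\Omega)$ is a weak super-solution in $\Omega$ if it is a weak super-solution in every bounded open set $\Omega'\subset\Omega$. For $c\in L^1_{loc}(\Omega)$, $u\in\mathcal{W}^{s,p}(\Omega)$ is a weak super-solution of $(-\Delta_p)^su=c(x)|u|^{p-2}u$ in $\Omega$ if $f:=c|u|^{p-2}u\in W^{-s,p'}(\Omega)$ and $u$ is a weak super-solution of $(-\Delta_p)^su=f$ in $\Omega$. *)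

(* Defs.v *)
From HB Require Import structures.
From mathcomp Require Import all_boot all_order all_algebra.
From mathcomp Require Import all_classical all_reals all_analysis.

Set Implicit Arguments.
Unset Strict Implicit.
Unset Printing Implicit Defensive.

Import Order.TTheory GRing.Theory Num.Theory.
Import numFieldNormedType.Exports.

Local Open Scope classical_set_scope.
Local Open Scope ring_scope.

(** R^N is ['rV[R]_N], with the library's topology. Its norm [`|x|] is the sup
    norm; the Euclidean norm is [enorm]. *)

Definition enorm (R : realType) (N : nat) (x : 'rV[R]_N) : R :=
  Num.sqrt (\sum_(i < N) x ord0 i ^+ 2).

(** The Borel sigma-algebra, generated by the coordinates (as the library does
    for tuples). *)


Section rV_measurable.
Variables (R : realType) (n : nat).

Definition rV_coord (i : 'I_n) (x : 'rV[R]_n) : measurableTypeR R := x ord0 i.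

Let rV_set0 : g_sigma_preimage rV_coord set0.
Proof. exact: sigma_algebra0. Qed.

Let rV_setC A : g_sigma_preimage rV_coord A -> g_sigma_preimage rV_coord (~` A).
Proof. exact: sigma_algebraC. Qed.

Let rV_bigcup (F : (set 'rV[R]_n)^nat) :
  (forall i, g_sigma_preimage rV_coord (F i)) ->
  g_sigma_preimage rV_coord (\bigcup_i (F i)).
Proof. exact: sigma_algebra_bigcup. Qed.

HB.instance Definition _ := @isMeasurable.Build default_measure_display
  'rV[R]_n (g_sigma_preimage rV_coord) rV_set0 rV_setC rV_bigcup.

End rV_measurable.

Section rV_measurable_fun.
Variables (R : realType) (d : measure_display) (T : measurableType d).

Lemma measurable_rV_coord n (i : 'I_n) :
  measurable_fun [set: 'rV[R]_n] (@rV_coord R n i).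
Proof.
move=> _ Y mY; rewrite setTI; apply: sub_sigma_algebra => /=.
rewrite -bigcup_seq/=; exists i => /=; first by rewrite mem_index_enum.
by exists Y => //; rewrite setTI.
Qed.

Lemma measurable_fun_rV n (f : T -> 'rV[R]_n) :
  (forall i, measurable_fun [set: T] (@rV_coord R n i \o f)) ->
  measurable_fun [set: T] f.
Proof.
move=> mf _ A mA; suff: g_sigma_preimage (fun i => @rV_coord R n i \o f)
    `<=` measurable by apply; rewrite g_sigma_preimage_comp; exists A.
apply: smallest_sub; first exact: sigma_algebra_measurable.
case: n => [|n] in f mf A mA *; first by rewrite big_ord0.
rewrite -bigcup_mkord_ord; apply: bigcup_sub => i Ii.
by move=> B [C mC <-]; exact: mf.
Qed.

End rV_measurable_fun.

(** Lebesgue measure on R^(n+1) = R x R^n is the image of the product measure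
    under [rV_cons]. *)

Definition rV_cons (R : realType) n (z : measurableTypeR R * 'rV[R]_n) :
  'rV[R]_n.+1 := row_mx (const_mx z.1 : 'rV_1) z.2.

Section rV_lebesgue_succ.
Variables (R : realType) (n : nat).
Variable m : {sigma_finite_measure set 'rV[R]_n -> \bar R}.

Let rV_uncons (x : 'rV[R]_n.+1) : measurableTypeR R * 'rV[R]_n :=
  (x ord0 ord0, \row_j x ord0 (lift ord0 j)).

Let rV_cons0 z : @rV_cons R n z ord0 ord0 = z.1.
Proof.
rewrite /rV_cons mxE; case: splitP => [j _|j /= jE]; first by rewrite mxE.
by [].
Qed.

Let rV_consS z j : @rV_cons R n z ord0 (lift ord0 j) = z.2 ord0 j.
Proof.
rewrite /rV_cons mxE; case: splitP => [k /= kE|k /= kE].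
  by have := ltn_ord k; rewrite -kE.
by congr (z.2 _ _); apply/val_inj; move: kE => /= [].
Qed.

Let rV_consK : cancel (@rV_cons R n) rV_uncons.
Proof.
move=> [a x]; rewrite /rV_uncons rV_cons0; congr pair.
by apply/rowP => j; rewrite mxE rV_consS.
Qed.

Lemma measurable_rV_cons : measurable_fun setT (@rV_cons R n).
Proof.
apply: measurable_fun_rV => i; case: (unliftP ord0 i) => [j ->|->].
  rewrite (_ : _ \o _ = @rV_coord R n j \o snd); last first.
    by apply/funext => z /=; rewrite /rV_coord rV_consS.
  by apply: measurableT_comp => //; exact: measurable_rV_coord.
rewrite (_ : _ \o _ = fst) //.
by apply/funext => z /=; rewrite /rV_coord rV_cons0.
Qed.

Let measurable_rV_uncons : measurable_fun setT rV_uncons.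
Proof.
apply: measurable_fun_pair; first exact: (@measurable_rV_coord R n.+1 ord0).
apply: measurable_fun_rV => j.
rewrite (_ : _ \o _ = @rV_coord R n.+1 (lift ord0 j)).
  exact: measurable_rV_coord.
by apply/funext => z /=; rewrite /rV_coord mxE.
Qed.

Definition rV_lebesgue_succ : set 'rV[R]_n.+1 -> \bar R :=
  pushforward (lebesgue_measure \x m)%E (@rV_cons R n).

Let succ0 : rV_lebesgue_succ set0 = 0%E.
Proof. by rewrite /rV_lebesgue_succ /pushforward preimage_set0 measure0. Qed.

Let succ_ge0 A : (0 <= rV_lebesgue_succ A)%E.
Proof. by rewrite /rV_lebesgue_succ /pushforward; exact: measure_ge0. Qed.

Let succ_sigma_additive : semi_sigma_additive rV_lebesgue_succ.
Proof.
move=> F mF tF mUF; rewrite /rV_lebesgue_succ /pushforward preimage_bigcup.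
apply: measure_semi_sigma_additive.
- by move=> k; rewrite -[X in measurable X]setTI; exact: measurable_rV_cons.
- apply/trivIsetP => /= i j _ _ ij; rewrite -preimage_setI.
  by move/trivIsetP : tF => /(_ _ _ _ _ ij) ->//; rewrite preimage_set0.
- rewrite -preimage_bigcup -[X in measurable X]setTI.
  exact: measurable_rV_cons.
Qed.

HB.instance Definition _ := isMeasure.Build _ _ _ rV_lebesgue_succ
  succ0 succ_ge0 succ_sigma_additive.

Let succ_sigma_finite : sigma_finite setT rV_lebesgue_succ.
Proof.
have /sigma_finiteP[F [TF ndF Foo]] := sigma_finiteT (@lebesgue_measure R).
have /sigma_finiteP[G [TG ndG Goo]] := sigma_finiteT m.
exists (fun k => rV_uncons @^-1` (F k `*` G k)).
  apply/seteqP; split=> // x _.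
  have /= [i _ Fi] : (\bigcup_i F i) (rV_uncons x).1 by rewrite -TF.
  have /= [j _ Gj] : (\bigcup_i G i) (rV_uncons x).2 by rewrite -TG.
  exists (maxn i j) => //; split.
    by move: Fi; apply/subsetPset/ndF/leq_maxl.
  by move: Gj; apply/subsetPset/ndG/leq_maxr.
move=> k; have [mF Fk] := Foo k; have [mG Gk] := Goo k.
split.
  rewrite -[X in measurable X]setTI.
  by apply: measurable_rV_uncons => //; exact: measurableX.
rewrite /rV_lebesgue_succ /pushforward -comp_preimage.
rewrite (_ : rV_uncons \o _ = id); last first.
  by apply/funext => z; exact: rV_consK.
by rewrite preimage_id product_measure1E// lte_mul_pinfty// ge0_fin_numE.
Qed.

HB.instance Definition _ := Measure_isSigmaFinite.Build _ _ _ rV_lebesgue_succ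
  succ_sigma_finite.

End rV_lebesgue_succ.

Section rV_lebesgue_0.
Variable R : realType.

Definition rV_lebesgue_0 : set 'rV[R]_0 -> \bar R :=
  \d_(0 : 'rV[R]_0).

HB.instance Definition _ := Measure.on rV_lebesgue_0.

Let sigma_finite_0 : sigma_finite setT rV_lebesgue_0.
Proof.
apply: fin_num_fun_sigma_finite; first by rewrite measure0.
by move=> A mA; rewrite /rV_lebesgue_0 diracE.
Qed.

HB.instance Definition _ := Measure_isSigmaFinite.Build _ _ _ rV_lebesgue_0
  sigma_finite_0.

End rV_lebesgue_0.

Fixpoint rV_lebesgue (R : realType) (n : nat) :
    {sigma_finite_measure set 'rV[R]_n -> \bar R} :=
  match n with
  | 0 => @rV_lebesgue_0 R
  | k.+1 => rV_lebesgue_succ (rV_lebesgue R k)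
  end.

Section fractional_sobolev.
Variables (R : realType) (N : nat) (s p : R).
Implicit Types (U Omega : set 'rV[R]_N) (u phi f c : 'rV[R]_N -> R).

Local Notation mu := (rV_lebesgue R N).

(** Elements of the Lebesgue and Sobolev spaces are represented by functions
    defined on all of R^N and Borel measurable on the relevant set (every a.e.
    class contains such a function); [u \_ U] is the extension by 0 of the
    restriction of [u] to [U]. *)

Definition memLp U u := u \_ U \in Lfun mu p%:E.

Definition memLp_loc u := forall K, compact K -> memLp K u.

Definition mem_L1loc Omega f := forall K : set 'rV[R]_N, compact K ->
  K `<=` Omega -> mu.-integrable K (EFin \o f).

Definition gagliardo U u : \bar R :=
  (\int[mu \x mu]_(z in U `*` U)
     (`|u z.1 - u z.2| `^ p / enorm (z.1 - z.2) `^ (N%:R + s * p))%:E)%E.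

Definition Wsp U u := memLp U u /\ (gagliardo U u < +oo)%E.

Definition Wsp_norm U u : \bar R :=
  (('N[mu]_p%:E[EFin \o (u \_ U)] `^ p + gagliardo U u) `^ p^-1)%E.

(** Elements of W~^{s,p}(Omega) are identified with their zero extensions, hence
    the last clause. *)
Definition Wtilde Omega phi :=
  [/\ Wsp Omega phi, Wsp setT (phi \_ Omega) & phi \_ Omega = phi].

(** W^{-s,p'}(Omega): [F] is only meaningful on [Wtilde Omega], which is normed
    as a subspace of W^{s,p}(R^N). The bound makes [F] a function of the a.e.
    class of its argument. *)
Definition Wdual Omega (F : ('rV[R]_N -> R) -> R) :=
  (forall (a : R) phi psi, Wtilde Omega phi -> Wtilde Omega psi ->
     F (a *: phi + psi) = a * F phi + F psi) /\
  (exists C : R, forall phi, Wtilde Omega phi ->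
     (`|F phi|%:E <= C%:E * Wsp_norm setT phi)%E).

Definition pairing Omega f phi : R := \int[mu]_(x in Omega) (f x * phi x).

Definition fun_in_Wdual Omega f :=
  (forall phi, Wtilde Omega phi ->
     mu.-integrable Omega (fun x => (f x * phi x)%:E)) /\
  Wdual Omega (pairing Omega f).

Definition Wcal Omega u :=
  [/\ memLp_loc u,
      forall Omega' : set 'rV[R]_N, bounded_set Omega' -> Omega' `<=` Omega ->
        exists U : set 'rV[R]_N, [/\ open U, compact (closure Omega'),
          closure Omega' `<=` U & Wsp U u]
    & (\int[mu]_x (`|u x| `^ (p - 1) / (1 + enorm x) `^ (N%:R + s * p))%:E
        < +oo)%E].

(** Since [`^] is total, the value at t = 0 is 0 for every p. *)
Definition spow (t : R) : R := `|t| `^ (p - 2) * t.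

Definition fracplap_form u phi : \bar R :=
  (\int[mu \x mu]_z
     (spow (u z.1 - u z.2) * (phi z.1 - phi z.2) /
      enorm (z.1 - z.2) `^ (N%:R + s * p))%:E)%E.

Definition weak_supersol_bounded Omega (F : ('rV[R]_N -> R) -> R) u :=
  [/\ Wdual Omega F, Wcal Omega u &
      forall phi, Wtilde Omega phi -> {ae mu, forall x, 0 <= phi x} ->
        ((F phi)%:E <= fracplap_form u phi)%E].

(** The restriction of a functional [F] on W~(Omega) to W~(Omega') is [F] itself,
    since elements of W~(Omega') are functions on R^N. *)
Definition weak_supersol Omega (F : ('rV[R]_N -> R) -> R) u :=
  [/\ Wdual Omega F, Wcal Omega u,
      bounded_set Omega -> weak_supersol_bounded Omega F u &
      ~ bounded_set Omega ->
        forall Omega' : set 'rV[R]_N, open Omega' -> bounded_set Omega' ->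
          Omega' `<=` Omega -> weak_supersol_bounded Omega' F u].

Definition weak_supersol_eq Omega c u :=
  let f := fun x => c x * spow (u x) in
  [/\ mem_L1loc Omega c, fun_in_Wdual Omega f &
      weak_supersol Omega (pairing Omega f) u].

End fractional_sobolev.

(* Main.v *)
Require Import Defs.
From mathcomp Require Import all_boot all_order all_algebra.
From mathcomp Require Import all_classical all_reals all_analysis.
From mathcomp Require Import measurable_realfun.
From mathcomp Require Import ring lra.

(** The minimum principle is proved by a De Giorgi iteration on the sets where
    [u] is small; it treats all [p > 1] alike.

    If [Omega] is bounded and [u >= 0] outside, the negative part of [u] is an
    admissible test function. Both the nonlocal form and the zero order term then
    have a sign (the latter because [c <= 0]), and this forces the interaction of
    the negative part with a distant ball, where it vanishes, to be zero. Hence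
    [u >= 0] almost everywhere ([weak_minimum_principle]), which reduces the first
    claim to the second one.

    Let now [u >= 0] with [u x0 <= 0] at some [x0] in [Omega], and suppose that
    [u >= del > 0] on a bounded set [S] of positive measure. The inequality is
    tested with [(k - u)_+ eta ^ p], where [eta] is a cut-off function between two
    balls around [x0]. A pair of points with [u x < k <= u y] contributes exactly
    minus the test function at [x] times [(u y - u x) ^ (p - 1)] times the kernel.
    A pair with [u] below [k] at both points contributes at most
    [C k ^ p |eta x - eta y| ^ p] times the kernel ([caccioppoli_pointwise]), and
    this is integrable because [s < 1] ([integral_trunc_kernel_le]). The zero order
    term is at least [- M k ^ p] times the measure of [{u < k}] in the larger ball.
    Thus the kernel mass that the points of a small sublevel set see above the level
    [k] is controlled by the measure of the next larger sublevel set
    ([sublevel_growth]). This estimate is used in two ways.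
    - Seen from [x0], the set [S] has a fixed mass at height [del]. Therefore
      [{u < k}] occupies near [x0] at most a multiple of [k ^ (p - 1)], which is as
      small as desired ([sublevel_small]).
    - Once [{u < k}] fills at most half of every ball of radius [rho], the kernel mass
      of the other half is of order [rho ^ (- s p)]. Lowering the level and
      shrinking the ball therefore gains a power of the measure, as the Sobolev
      inequality does in the classical scheme ([dg_step]), and the measures tend
      to zero ([sublevel_not_nbhs]).
    So [{u < k}] is not a neighbourhood of [x0] for some [k > 0], which contradicts
    the continuity of [u] ([strong_minimum_principle]).

    Balls are those of the sup norm, whose measure is explicit; the Euclidean norm
    only enters through the kernel and is compared with the sup norm. *)

Set Implicit Arguments.
Unset Strict Implicit.
Unset Printing Implicit Defensive.

Import Order.TTheory GRing.Theory Num.Theory.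
Import numFieldNormedType.Exports.

Local Open Scope classical_set_scope.
Local Open Scope ring_scope.

(** * The sup norm, open sets and the measure of balls *)

Section sup_norm.
Context {R : realType} {N : nat}.
Implicit Types x y z : 'rV[R]_N.

Lemma rV_coord_le_norm x (i : 'I_N) : `|x ord0 i| <= `|x|.
Proof.
rewrite [leRHS]/Num.norm /= mx_normrE.
exact: (le_bigmax _ (fun ij : 'I_1 * 'I_N => `|x ij.1 ij.2|) (ord0, i)).
Qed.

Lemma rV_subE x y (i : 'I_N) : (x - y) ord0 i = x ord0 i - y ord0 i.
Proof. by rewrite !mxE. Qed.

Lemma rV_norm_ltP x r : 0 < r -> `|x| < r <-> forall i : 'I_N, `|x ord0 i| < r.
Proof.
move=> r0; split=> [xr i|xr]; first exact: le_lt_trans (rV_coord_le_norm x i) xr.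
rewrite [ltLHS]/Num.norm /= mx_normrE; apply/bigmax_ltP; split => //= -[i j] _ /=.
by rewrite ord1.
Qed.

Lemma norm_le_enorm x : `|x| <= enorm x.
Proof.
rewrite [leLHS]/Num.norm /= mx_normrE; apply/bigmax_leP; split.
  exact: sqrtr_ge0.
move=> [i j] _ /=; rewrite ord1 -sqrtr_sqr ler_sqrt ?sumr_ge0//=; last first.
  by move=> k _; exact: sqr_ge0.
rewrite (bigD1 j) //= lerDl sumr_ge0 // => k _; exact: sqr_ge0.
Qed.


Lemma enorm_le_norm x : enorm x <= N%:R * `|x|.
Proof.
rewrite -[leRHS]ger0_norm ?mulr_ge0// -sqrtr_sqr ler_sqrt ?sqr_ge0//.
apply: (@le_trans _ _ (\sum_(i < N) `|x| ^+ 2)).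
  apply: ler_sum => i _; rewrite -[leLHS]real_normK ?num_real//.
  by rewrite lerXn2r// ?nnegrE// rV_coord_le_norm.
rewrite sumr_const card_ord exprMn -[leLHS]mulr_natl ler_wpM2r ?sqr_ge0//.
by rewrite -natrX ler_nat; case: (N) => // n; rewrite leq_pmull.
Qed.

Lemma enormN x : enorm (- x) = enorm x.
Proof.
by rewrite /enorm; congr Num.sqrt; apply: eq_bigr => i _; rewrite mxE sqrrN.
Qed.

Lemma enormB x y : enorm (x - y) = enorm (y - x).
Proof. by rewrite -enormN opprB. Qed.

Lemma enorm_ge0 x : 0 <= enorm x.
Proof. exact: sqrtr_ge0. Qed.

Lemma enorm0 : enorm (0 : 'rV[R]_N) = 0.
Proof.
by apply/eqP; rewrite eq_le enorm_ge0 (le_trans (enorm_le_norm _))// normr0 mulr0.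
Qed.

Lemma enorm_gt0 x : x != 0 -> 0 < enorm x.
Proof. by move=> x0; apply: lt_le_trans (norm_le_enorm x); rewrite normr_gt0. Qed.

Lemma rV_ballE x r : ball x r = [set y | `|x - y| < r].
Proof. by rewrite -ball_normE. Qed.

End sup_norm.

Section rV_measurability.
Context {R : realType} {N : nat}.
Local Notation mu := (rV_lebesgue R N).

Lemma measurable_rV_entry (i : 'I_N) :
  measurable_fun setT (fun x : 'rV[R]_N => x ord0 i).
Proof. exact: measurable_rV_coord. Qed.

Lemma measurable_rV_sub d (T : measurableType d) (f g : T -> 'rV[R]_N) :
  measurable_fun setT f -> measurable_fun setT g ->
  measurable_fun setT (fun x => f x - g x).
Proof.
move=> mf mg; apply: measurable_fun_rV => i.
rewrite (_ : _ \o _ = (fun x => f x ord0 i - g x ord0 i)); last first.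
  by apply/funext => x /=; rewrite /rV_coord !mxE.
by apply: measurable_funB; exact: (measurableT_comp (measurable_rV_entry i)).
Qed.

Lemma measurable_rV_norm : measurable_fun setT (fun x : 'rV[R]_N => `|x|).
Proof.
rewrite (_ : (fun _ => _) = fun x : 'rV[R]_N =>
  \big[Num.max/0]_(ij : 'I_1 * 'I_N) `|x ij.1 ij.2|); last first.
  by apply/funext => x; rewrite -mx_normrE.
elim: (index_enum _) => [|[i j] s IH].
  by under eq_fun do rewrite big_nil; exact: measurable_cst.
under eq_fun do rewrite big_cons; apply: measurable_maxr => //=.
by rewrite ord1; apply: measurableT_comp => //; exact: measurable_rV_entry.
Qed.

Lemma measurable_enorm : measurable_fun setT (@enorm R N).
Proof.
apply: (measurableT_comp (continuous_measurable_fun (@sqrt_continuous R))).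
by apply: measurable_sum => i; apply: measurable_funX; exact: measurable_rV_entry.
Qed.

Lemma measurable_rV_ball (x : 'rV[R]_N) r : measurable (ball x r).
Proof.
rewrite rV_ballE -[X in measurable X]setTI.
have mf : measurable_fun setT (fun y : 'rV[R]_N => `|x - y|).
  by apply: (measurableT_comp measurable_rV_norm); exact: measurable_rV_sub.
rewrite (_ : [set y | _] = (fun y => `|x - y|) @^-1` [set` `]-oo, r[]); last first.
  by apply/seteqP; split => y /=; rewrite in_itv.
exact: mf.
Qed.

(** Open sets are countable unions of balls with rational centres and radii,
    hence belong to the sigma-algebra generated by the coordinates. *)
Lemma rV_open_measurable (U : set 'rV[R]_N) : open U -> measurable U.
Proof.
move=> oU; pose q (c : 'rV[rat]_N) : 'rV[R]_N := map_mx ratr c.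
pose B (cn : 'rV[rat]_N * nat) := ball (q cn.1) (cn.2.+1%:R^-1 : R).
have -> : U = \bigcup_(cn in [set cn | B cn `<=` U]) B cn.
  apply/seteqP; split; last by move=> x [cn /= /[apply]].
  move=> x Ux; have /nbhs_ballP[e /= e0 xeU] : nbhs x U by exact: open_nbhs_nbhs.
  have [n ne] : exists n, (n.+1%:R^-1 : R) < e / 2.
    exists (Num.bound (2 / e)); rewrite invf_plt ?posrE ?divr_gt0//.
    rewrite invf_div (le_lt_trans (ler_norm _))// -[ltRHS]gtr0_norm//.
    apply: (@lt_le_trans _ _ (Num.bound (2 / e))%:R); last by rewrite normr_nat ler_nat.
    by have := archi_boundP (normr_ge0 (2 / e)); rewrite /Num.bound normr_id.
  have /choice[c cP] : forall i : 'I_N, exists c : rat,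
      `|ratr c - x ord0 i| < (n.+1%:R^-1 : R).
    move=> i; have [] := @rat_in_itvoo R (x ord0 i - n.+1%:R^-1) (x ord0 i + n.+1%:R^-1).
      by rewrite ltrD2l gtrN.
    by move=> c; rewrite in_itv /= => xc; exists c; rewrite ltr_distl.
  have qB : `|q (\row_i c i) - x| < (n.+1%:R^-1 : R).
    by apply/rV_norm_ltP => // i; rewrite !mxE.
  exists (\row_i c i, n); last by rewrite /B rV_ballE.
  rewrite /= /B !rV_ballE /= => y /= qy; apply: xeU; rewrite rV_ballE /=.
  rewrite -(subrK (q (\row_i c i)) x) -addrA (le_lt_trans (ler_normD _ _))//.
  by rewrite [e]splitr ltrD// ?(lt_trans qy)// distrC (lt_trans qB).
rewrite (_ : \bigcup_(cn in _) B cn = \bigcup_i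
    (if unpickle i is Some cn then [set y | B cn `<=` U /\ B cn y] else set0)).
  apply: bigcup_measurable => i _; case: unpickle => // cn.
  have [BU|BU] := pselect (B cn `<=` U).
    rewrite (_ : [set _ | _] = B cn); first exact: measurable_rV_ball.
    by apply/seteqP; split => y /=; [case|].
  rewrite (_ : [set _ | _] = set0)//.
  by apply/seteqP; split => y //= [].
apply/seteqP; split => y [i Bi].
  by move=> Biy; exists (pickle i) => //; rewrite pickleK.
by case: unpickle => // cn [BU Bcn]; exists cn.
Qed.

Lemma rV_closed_measurable (A : set 'rV[R]_N) : closed A -> measurable A.
Proof.
by move=> cA; rewrite -[A]setCK; apply: measurableC; apply: rV_open_measurable;
  exact: closed_openC.
Qed.

End rV_measurability.

Lemma rV_cons_head (R : realType) n (z : measurableTypeR R * 'rV[R]_n) :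
  rV_cons z ord0 ord0 = z.1.
Proof.
by rewrite /rV_cons mxE; case: splitP => [j _|j /= jE] //; rewrite mxE.
Qed.

Lemma rV_cons_tail (R : realType) n (z : measurableTypeR R * 'rV[R]_n) j :
  rV_cons z ord0 (lift ord0 j) = z.2 ord0 j.
Proof.
rewrite /rV_cons mxE; case: splitP => [k /= kE|k /= kE].
  by have := ltn_ord k; rewrite -kE.
by congr (z.2 _ _); apply/val_inj; move: kE => /= [].
Qed.

(** By induction on the dimension: a sup-norm ball is the product of an interval
    and of a lower dimensional ball. *)
Lemma rV_lebesgue_ball (R : realType) n (x : 'rV[R]_n) r : 0 < r ->
  rV_lebesgue R n (ball x r) = ((2 * r) ^+ n)%:E.
Proof.
move=> r0; elim: n x => [|n IH] x.
  rewrite /= /rV_lebesgue_0 diracE mem_set ?expr0//.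
  by rewrite rV_ballE /=; apply/rV_norm_ltP => // -[].
rewrite /= /rV_lebesgue_succ /pushforward.
rewrite (_ : _ @^-1` _ = (ball (x ord0 ord0) r : set R) `*`
    ball (\row_j x ord0 (lift ord0 j) : 'rV[R]_n) r); last first.
  apply/seteqP; split => z; rewrite /= !rV_ballE /=.
    move/(rV_norm_ltP _ r0) => H; split.
      by have := H ord0; rewrite rV_subE rV_cons_head.
    by apply/rV_norm_ltP => // i; have := H (lift ord0 i); rewrite !rV_subE rV_cons_tail mxE.
  move=> [H1 /(rV_norm_ltP _ r0) H2]; apply/rV_norm_ltP => // i.
  case: (unliftP ord0 i) => [j ->|->]; last by rewrite rV_subE rV_cons_head.
  by have := H2 j; rewrite !rV_subE rV_cons_tail mxE.
rewrite product_measure1E //; [|exact: measurable_ball|exact: measurable_rV_ball].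
have ballR := lebesgue_measure_ball (x ord0 ord0) (ltW r0).
apply: (eq_trans (f_equal2 mule ballR (IH _))).
by rewrite exprS EFinM mulr2n mulrDl mul1r.
Qed.

(** * Integrability of the truncated kernel *)

(** Pointwise domination by one member of a family of functions suffices when the
    integrals of the family decay geometrically, since the sum of the family
    dominates every member. *)
Lemma integral_le_geometric d (T : measurableType d) (R : realType)
    (m : {measure set T -> \bar R}) (g : T -> \bar R) (F : nat -> T -> \bar R)
    (a r : R) :
  measurable_fun setT g -> (forall j, measurable_fun setT (F j)) ->
  (forall y, 0 <= g y)%E -> (forall j y, 0 <= F j y)%E ->
  (forall y, exists j, g y <= F j y)%E ->
  0 <= a -> 0 <= r < 1 ->
  (forall j, \int[m]_y F j y <= (a * r ^+ j)%:E)%E ->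
  (\int[m]_y g y <= (a / (1 - r))%:E)%E.
Proof.
move=> mg mF g0 F0 gF a0 /andP[r0 r1] intF.
apply: (@le_trans _ _ (\int[m]_y \big[+%E/0%E]_(0 <= j <oo) F j y)%E).
  apply: ge0_le_integral => //.
  - by apply: ge0_emeasurable_sum => // j y _ _; exact: F0.
  - move=> y _; have [j gj] := gF y; apply: (le_trans gj).
    apply: le_trans (nneseries_lim_ge j.+1 _); last by move=> i _ _; exact: F0.
    by rewrite big_nat_recr//= leeDr// sume_ge0.
rewrite integral_nneseries//.
apply: lime_le; first by apply: is_cvg_nneseries => j _ _; exact: integral_ge0.
near=> n; apply: (@le_trans _ _ (\sum_(0 <= i < n) (a * r ^+ i)%:E)%E).
  by apply: lee_sum => i _; exact: intF.
rewrite sumEFin lee_fin.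
have r1' : 1 - r != 0 by rewrite subr_eq0 gt_eqF.
rewrite -[leLHS]/(series (geometric a r) n) geometric_seriesE ?lt_eqF// /=.
rewrite ler_pM2r ?invr_gt0 ?subr_gt0// ler_piMr// gerBl exprn_ge0 //.
Unshelve. all: by end_near. Qed.

Lemma ltr_powR_exponent (R : realType) (a x y : R) :
  1 < a -> (a `^ x < a `^ y) = (x < y).
Proof.
move=> a1; have a0 : 0 < a by exact: lt_trans a1.
by rewrite /powR gt_eqF// ltr_expR ltr_pM2r// ln_gt0.
Qed.

Lemma exists_dyadic (R : realType) (t : R) : 1 <= t ->
  exists j : nat, 2 `^ j%:R <= t < 2 `^ (j%:R + 1).
Proof.
move=> t1; have ex : exists n : nat, t < 2 `^ (n%:R + 1).
  exists (Num.bound t); rewrite (lt_le_trans (archi_boundP _)) ?(le_trans ler01)//.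
  rewrite natr1 powR_mulrn// -natrX ler_nat (leq_trans _ (ltnW (ltn_expl _ _)))//.
case: (ex_minnP ex) => j tj minj; exists j; rewrite tj andbT.
case: j tj minj => [_ _|j _ minj]; first by rewrite powRr0.
rewrite leNgt -(@natr1 _ j); apply/negP => /minj; by rewrite ltnn.
Qed.

Section kernel.
Context {R : realType} {N : nat}.
Local Notation mu := (rV_lebesgue R N).

Lemma measurable_inv_enorm_powR d (T : measurableType d) (f g : T -> 'rV[R]_N) q :
  measurable_fun setT f -> measurable_fun setT g ->
  measurable_fun setT (fun z => (enorm (f z - g z) `^ q)^-1).
Proof.
move=> mf mg; under eq_fun do rewrite -powRN.
apply: (measurableT_comp (measurable_powR _)).
by apply: (measurableT_comp measurable_enorm); exact: measurable_rV_sub.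
Qed.

Lemma kernel_le_norm (q : R) (h : 'rV[R]_N) : 0 <= q -> h != 0 ->
  (enorm h `^ q)^-1 <= (`|h| `^ q)^-1.
Proof.
move=> q0 h0; have n0 : 0 < `|h| by rewrite normr_gt0.
rewrite lef_pV2 ?posrE ?powR_gt0 ?enorm_gt0//.
by rewrite ge0_ler_powR ?nnegrE ?enorm_ge0 ?norm_le_enorm.
Qed.

(** The truncated kernel is integrable near the diagonal because [q < N + p], and
    at infinity because [N < q]; both are read off dyadic balls. *)
Lemma integral_kernel_le (p q : R) : N%:R < q -> q < N%:R + p ->
  exists2 K : R, 0 <= K & forall x : 'rV[R]_N,
    (\int[mu]_y (Num.min 1 `|x - y| `^ p / enorm (x - y) `^ q)%:E <= K%:E)%E.
Proof.
move=> Nq qNp; have N0 : 0 <= N%:R :> R by [].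
have q0 : 0 < q by exact: le_lt_trans Nq.
pose r : R := Num.max (2 `^ (q - N%:R - p)) (2 `^ (N%:R - q)).
have r0 : 0 <= r by rewrite /r le_max !powR_ge0.
have r1 : r < 1.
  rewrite /r gt_max; apply/andP; split; rewrite -[ltRHS](powRr0 2).
    by rewrite ltr_powR_exponent ?ltr1n//; lra.
  by rewrite ltr_powR_exponent ?ltr1n//; lra.
pose a : R := 2 `^ (2 * N%:R + q) + 2 `^ (2 * N%:R).
have a0 : 0 <= a by rewrite addr_ge0 ?powR_ge0.
exists (a / (1 - r)); first by rewrite divr_ge0// subr_ge0 ltW.
move=> x.
pose A (j : nat) : R := 2 `^ (- j%:R * p + (j%:R + 1) * q).
pose B (j : nat) : R := 2 `^ (- j%:R * q).
pose near (j : nat) := ball x (2 `^ (1 - j%:R) : R).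
pose far (j : nat) := ball x (2 `^ (j%:R + 1) : R).
have A0 j : 0 <= A j by exact: powR_ge0.
have B0 j : 0 <= B j by exact: powR_ge0.
have p2 (t u : R) : 2 `^ t * 2 `^ u = 2 `^ (t + u).
  by rewrite powRD// pnatr_eq0 implybT.
have x2 (t : R) n : (2 `^ t) ^+ n = 2 `^ (t * n%:R).
  by rewrite powRrM powR_mulrn ?powR_ge0.
have vol (t : R) : ((2 * 2 `^ t) ^+ N)%:E = mu (ball x (2 `^ t)).
  by rewrite rV_lebesgue_ball// powR_gt0.
have mball t : measurable (ball x t) by exact: measurable_rV_ball.
have mI t : measurable_fun setT (fun y => (\1_(ball x t) y : R)%:E).
  by apply/measurable_EFinP; apply: measurable_indic; exact: mball.
(* A point at distance at most 1 from x lies in some ball near j, the others in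
   some ball far j, at a distance comparable with the radius. *)
pose F (j : nat) (y : 'rV[R]_N) :=
  ((A j)%:E * (\1_(near j) y)%:E + (B j)%:E * (\1_(far j) y)%:E)%E.
apply: (@integral_le_geometric _ _ _ _ _ F) => //.
- apply/measurable_EFinP; apply: measurable_funM.
    apply: (measurableT_comp (measurable_powR _)); apply: measurable_minr => //.
    by apply: (measurableT_comp measurable_rV_norm); exact: measurable_rV_sub.
  exact: measurable_inv_enorm_powR.
- move=> j; apply: emeasurable_funD; apply: measurable_funeM; exact: mI.
- by move=> y; rewrite lee_fin divr_ge0 ?powR_ge0.
- by move=> j y; rewrite adde_ge0// mule_ge0 ?lee_fin.
- move=> y; have [->|xy] := eqVneq y x.
    exists 0%N; rewrite subrr normr0 enorm0 powR0 ?(gt_eqF q0)// invr0 mulr0.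
    by rewrite adde_ge0// mule_ge0 ?lee_fin.
  have xy0 : x - y != 0 by rewrite subr_eq0 eq_sym.
  have n0 : 0 < `|x - y| by rewrite normr_gt0.
  have p0 : 0 < p by lra.
  have ge0 : 0 <= Num.min 1 `|x - y| `^ p by exact: powR_ge0.
  have kn := kernel_le_norm (ltW q0) xy0.
  case: (leP 1 `|x - y|) => n1; last first.
    have [|j /andP[j1 j2]] := @exists_dyadic R `|x - y|^-1; first by rewrite invf_ge1 ?ltW.
    have {}j1 : `|x - y| <= 2 `^ (- j%:R).
      by rewrite powRN -[leLHS]invrK lef_pV2 ?posrE ?powR_gt0 ?invr_gt0.
    exists j; apply: (@le_trans _ _ (A j)%:E).
      have -> : A j = (2 `^ (- j%:R)) `^ p * (2 `^ (j%:R + 1)) `^ q.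
        by rewrite -!powRrM p2.
      rewrite lee_fin; apply: ler_pM; rewrite ?invr_ge0 ?powR_ge0//; last first.
        have E : `|x - y|^-1 `^ q = (`|x - y| `^ q)^-1.
          by rewrite -(powR_inv1 (normr_ge0 (x - y))) -powRrM mulN1r powRN.
        rewrite (le_trans kn)// -E.
        by rewrite ge0_ler_powR ?nnegrE ?(ltW q0) ?invr_ge0 ?powR_ge0// ltW.
      by apply: ge0_ler_powR; rewrite ?nnegrE ?powR_ge0 ?(ltW p0)// (ltW n0).
    rewrite /F indicE mem_set ?mule1.
      by rewrite leeDl// mule_ge0 ?lee_fin.
    rewrite /near rV_ballE /=; apply: (le_lt_trans j1).
    by rewrite ltr_powR_exponent ?ltr1n//; lra.
  have [j /andP[j1 j2]] := exists_dyadic n1.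
  exists j; apply: (@le_trans _ _ (B j)%:E).
    rewrite lee_fin powR1 mul1r; apply: (le_trans kn).
    rewrite /B mulNr powRN lef_pV2 ?posrE ?powR_gt0// powRrM.
    by rewrite ge0_ler_powR ?nnegrE ?(ltW q0) ?powR_ge0.
  rewrite /F [in X in (_ <= _ + X)%E]indicE mem_set ?mule1.
    by rewrite leeDr// mule_ge0 ?lee_fin.
  by rewrite /far rV_ballE.
- by rewrite r0.
- move=> j; rewrite ge0_integralD//; first last.
  - apply: measurable_funeM; exact: mI.
  - by move=> y _; rewrite mule_ge0 ?lee_fin.
  - apply: measurable_funeM; exact: mI.
  - by move=> y _; rewrite mule_ge0 ?lee_fin.
  rewrite !ge0_integralZl_EFin//; first last.
  - exact: mI.
  - exact: mI.
  rewrite !integral_indic//; [|exact: mball|exact: mball].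
  rewrite !setIT /near /far -[X in (_ * X + _)%E]vol -[X in (_ + _ * X)%E]vol -!EFinM -EFinD lee_fin.
  rewrite [leRHS]mulrDl; apply: lerD.
    rewrite (_ : A j * _ = 2 `^ (2 * N%:R + q) * (2 `^ (q - N%:R - p)) ^+ j).
      rewrite ler_wpM2l ?powR_ge0// lerXn2r ?nnegrE ?powR_ge0//.
      by rewrite /r le_max lexx.
    rewrite -[X in _ * (X * _) ^+ _](@powRr1 R)// p2 !x2 /A !p2; congr powR; ring.
  rewrite (_ : B j * _ = 2 `^ (2 * N%:R) * (2 `^ (N%:R - q)) ^+ j).
    rewrite ler_wpM2l ?powR_ge0// lerXn2r ?nnegrE ?powR_ge0//.
    by rewrite /r le_max lexx orbT.
  rewrite -[X in _ * (X * _) ^+ _](@powRr1 R)// p2 !x2 /B !p2; congr powR; ring.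
Qed.
End kernel.

(** * Pointwise inequalities *)

Section real_inequalities.
Context {R : realType} (p : R) (p_gt1 : 1 < p).
Implicit Types a b t k : R.

Lemma spowN t : spow p (- t) = - spow p t.
Proof. by rewrite /spow normrN mulrN. Qed.

Lemma spow_ge0E t : 0 <= t -> spow p t = t `^ (p - 1).
Proof.
rewrite le_eqVlt => /predU1P[<-|t0].
  by rewrite /spow mulr0 powR0// subr_eq0 gt_eqF.
rewrite /spow gtr0_norm// -[X in _ * X](powRr1 (ltW t0)) -powRD ?(gt_eqF t0) ?implybT//.
by congr powR; ring.
Qed.

Lemma powR_subr1_mulr t : 0 <= t -> t `^ (p - 1) * t = t `^ p.
Proof. by move=> t0; rewrite mulrC mulr_powRB1// (lt_trans _ p_gt1). Qed.

(** Convexity of [t `^ p], in the form of its tangent at [b]. *)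
Lemma powR_tangent a b : 0 <= a -> 0 <= b ->
  b `^ p - a `^ p <= p * b `^ (p - 1) * (b - a).
Proof.
have p1 := p_gt1.
move=> a0 b0; have p0 : 0 < p by lra.
have q0 : 0 < p / (p - 1) by rewrite divr_gt0// subr_gt0.
(* Young's inequality for a and b ^ (p - 1). *)
have := conjugate_powR a0 (powR_ge0 b (p - 1)) p0 q0.
have pq : p^-1 + (p / (p - 1))^-1 = 1 by field; lra.
move=> /(_ pq); rewrite -powRrM (_ : (p - 1) * _ = p); last by field; lra.
move=> young; have {}young : p * (a * b `^ (p - 1)) <= a `^ p + (p - 1) * b `^ p.
  rewrite -(ler_pM2l p0) in young; apply: (le_trans young).
  by rewrite le_eqVlt; apply/orP; left; apply/eqP; field; lra.
have := powR_subr1_mulr b0; nra.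
Qed.

Definition caccioppoli_cst : R := (p * 2 `^ (p - 1)) `^ p.

Lemma caccioppoli_cst_ge0 : 0 <= caccioppoli_cst.
Proof. exact: powR_ge0. Qed.

(** If [be <= 2 (be - al)], the cut-off is of the order of its own variation and the
    estimate is crude. Otherwise [be <= 2 al], the tangent inequality produces the
    error [(t al) ^ (p - 1) * B] with [B] of order [V (be - al)], and the gain
    [(t al) ^ p] absorbs it up to [B ^ p]. *)
Lemma caccioppoli_absorb (t V k al be : R) : 0 <= t -> 0 <= V -> t + V <= k ->
  0 <= al -> al <= be ->
  t `^ (p - 1) * (V * (be `^ p - al `^ p) - t * al `^ p) <=
  caccioppoli_cst * (k `^ p * (be - al) `^ p).
Proof.
have p1 := p_gt1.
move=> t0 V0 tVk al0 albe; have p0 : 0 < p by lra.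
have be0 : 0 <= be by lra.
have D0 : 0 <= be - al by lra.
have tk : t <= k by lra.
have k0 : 0 <= k by lra.
pose c : R := p * 2 `^ (p - 1).
have c1 : 1 <= c.
  by rewrite -[leLHS]mulr1 ler_pM ?(ltW p_gt1)// -[leLHS](powRr0 2) ler_powR ?ler1n// subr_ge0 ltW.
have tp0 : 0 <= t `^ (p - 1) by exact: powR_ge0.
have tangent := powR_tangent al0 be0.
have tal0 : 0 <= t * al by exact: mulr_ge0.
apply: (@le_trans _ _ (t `^ (p - 1) * V * (p * be `^ (p - 1) * (be - al)) - (t * al) `^ p)).
  rewrite powRM// -(powR_subr1_mulr t0) mulrBr mulrA -!mulrA lerD2r.
  by rewrite !mulrA -!mulrA ler_wpM2l// ler_wpM2l// !mulrA.
have [big|small] := leP be (2 * (be - al)).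
  rewrite -[leRHS]subr0 lerB ?powR_ge0//.
  apply: (@le_trans _ _ (k `^ p * (c * (be - al) `^ p))).
    apply: ler_pM; rewrite ?mulr_ge0 ?powR_ge0//.
    - by rewrite ltW.
    - rewrite -(powR_subr1_mulr k0) ler_pM//; last by lra.
      by rewrite ge0_ler_powR ?nnegrE//; lra.
    rewrite /c -!mulrA ler_wpM2l ?(ltW p0)// -(powR_subr1_mulr D0) mulrA ler_wpM2r//.
    by rewrite -powRM// ge0_ler_powR ?nnegrE ?mulr_ge0//; lra.
  rewrite mulrCA ler_wpM2r ?mulr_ge0 ?powR_ge0//.
  by rewrite /caccioppoli_cst le1r_powR// ltW.
have beal : be <= 2 * al by lra.
pose B := c * V * (be - al).
have B0 : 0 <= B by rewrite !mulr_ge0//; lra.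
apply: (@le_trans _ _ ((t * al) `^ (p - 1) * B - (t * al) `^ p)).
  have beal1 : be `^ (p - 1) <= 2 `^ (p - 1) * al `^ (p - 1).
    by rewrite -powRM// ge0_ler_powR ?nnegrE//; lra.
  rewrite lerD2r powRM// [leLHS](_ : _ = t `^ (p - 1) * V * p * (be - al) *
    be `^ (p - 1)); last by ring.
  rewrite [leRHS](_ : _ = t `^ (p - 1) * V * p * (be - al) *
    (2 `^ (p - 1) * al `^ (p - 1))); last by rewrite /B /c; ring.
  by rewrite ler_wpM2l// !mulr_ge0// ltW.
rewrite -(powR_subr1_mulr tal0) -mulrBr.
have [le|lt] := leP B (t * al).
  apply: (@le_trans _ _ 0); last by rewrite !mulr_ge0 ?powR_ge0.
  by rewrite mulr_ge0_le0 ?powR_ge0// subr_le0.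
apply: (@le_trans _ _ (B `^ p)).
  rewrite -(powR_subr1_mulr B0) ler_pM ?powR_ge0// ?subr_ge0 ?(ltW lt)//; last first.
    by rewrite gerBl.
  by rewrite ge0_ler_powR ?nnegrE// ?(ltW lt)// subr_ge0 ltW.
have c0 : 0 <= c by lra.
rewrite /B -mulrA (powRM p c0 (mulr_ge0 V0 D0)) ler_wpM2l ?powR_ge0//.
rewrite powRM// ler_wpM2r ?powR_ge0//.
by rewrite ge0_ler_powR ?nnegrE ?(ltW p0)//; lra.
Qed.

(** The integrand of the form tested with [(k - u)_+ eta ^ p] at a pair of points
    where [u] takes the values [a], [b] below [k], and [eta] the values [al], [be]. *)
Lemma caccioppoli_pointwise (a b k al be : R) : 0 <= a -> a <= k -> 0 <= b -> b <= k ->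
  0 <= al -> 0 <= be ->
  spow p (a - b) * ((k - a) * al `^ p - (k - b) * be `^ p) <=
  caccioppoli_cst * (k `^ p * `|al - be| `^ p).
Proof.
have p1 := p_gt1.
wlog ab : a b al be / a <= b.
  move=> H a0 ak b0 bk al0 be0; have [ab|ba] := leP a b; first exact: H.
  have := H b a be al (ltW ba) b0 bk a0 ak be0 al0.
  by rewrite distrC -mulrNN -spowN !opprB.
move=> a0 ak b0 bk al0 be0.
rewrite -[a - b]opprB spowN spow_ge0E ?subr_ge0// mulNr -mulrN opprB.
rewrite [X in _ * X <= _](_ : _ = (k - b) * (be `^ p - al `^ p) - (b - a) * al `^ p); last by ring.
have t0 : 0 <= b - a by lra.
have [albe|beal] := leP al be.
  rewrite distrC ger0_norm ?subr_ge0//.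
  by apply: caccioppoli_absorb => //; lra.
apply: (@le_trans _ _ 0); last by rewrite !mulr_ge0 ?powR_ge0.
rewrite mulr_ge0_le0 ?powR_ge0// subr_le0.
apply: (@le_trans _ _ 0); last by rewrite mulr_ge0 ?powR_ge0.
rewrite mulr_ge0_le0 ?subr_le0// ?subr_ge0//.
by rewrite ge0_ler_powR ?nnegrE ?(ltW beal)//; lra.
Qed.

Lemma powR_dist_le (al be : R) : 0 <= al <= 1 -> 0 <= be <= 1 ->
  `|al `^ p - be `^ p| <= p * `|al - be|.
Proof.
have p1 := p_gt1.
wlog ab : al be / be <= al.
  move=> H al01 be01; have [ba|ab] := leP be al; first exact: H.
  by rewrite distrC [X in _ <= _ * X]distrC; apply: H => //; exact: ltW.
move=> /andP[al0 al1] /andP[be0 be1].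
rewrite !ger0_norm ?subr_ge0//; last by rewrite ge0_ler_powR ?nnegrE//; lra.
apply: (le_trans (powR_tangent be0 al0)); rewrite ler_wpM2r ?subr_ge0//.
rewrite -[leRHS]mulr1 ler_wpM2l ?(ltW (lt_trans ltr01 p1))//.
apply: (@le_trans _ _ (1 `^ (p - 1))); last by rewrite powR1.
by rewrite ge0_ler_powR ?nnegrE//; lra.
Qed.

End real_inequalities.

(** * Double integrals *)

(** How an inequality [F <= form] is exploited: a divergent negative part would make
    the integral of [f] equal to [-oo], so that the lower bound [F] controls it. *)
Lemma integral_absorb d (T : measurableType d) (R : realType)
    (m : {measure set T -> \bar R}) (f g1 g2 : T -> R) (F G : R) :
  measurable_fun setT f -> measurable_fun setT g1 -> measurable_fun setT g2 ->
  (forall z, 0 <= g1 z) -> (forall z, 0 <= g2 z) ->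
  (forall z, f z + g2 z <= g1 z) ->
  (F%:E <= \int[m]_z (f z)%:E)%E ->
  (\int[m]_z (g1 z)%:E <= G%:E)%E ->
  (\int[m]_z (g2 z)%:E <= (2 * G - F)%:E)%E.
Proof.
move=> mf mg1 mg2 g10 g20 fg; rewrite integralE => Ff g1G.
set fe := fun z => (f z)%:E in Ff *.
have mfe : measurable_fun setT fe by exact/measurable_EFinP.
have fp : (\int[m]_z fe^\+ z <= G%:E)%E.
  apply: le_trans g1G; apply: ge0_le_integral => //.
  - exact: measurable_funepos.
  - exact/measurable_EFinP.
  - move=> z _; rewrite funeposE /fe ge_max !lee_fin g10 andbT.
    by have := fg z; have := g20 z; lra.
have fn0 : (0 <= \int[m]_z fe^\- z)%E by exact: integral_ge0.
have fn : (\int[m]_z fe^\- z <= (G - F)%:E)%E.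
  have fp0 : (0 <= \int[m]_z fe^\+ z)%E by apply: integral_ge0 => z _; exact: funepos_ge0.
  move: Ff fp fn0 fp0.
  case: (\int[m]_z fe^\- z)%E => [r| |]; case: (\int[m]_z fe^\+ z)%E => [t| |] //=.
  by rewrite -EFinB !lee_fin; lra.
apply: (@le_trans _ _ (\int[m]_z (fe^\- z + (g1 z)%:E))%E).
  apply: ge0_le_integral => //.
  - by move=> z _; rewrite lee_fin.
  - exact/measurable_EFinP.
  - by apply: emeasurable_funD; [exact: measurable_funeneg|exact/measurable_EFinP].
  - move=> z _; rewrite funenegE /fe -EFinN -EFin_max -EFinD lee_fin.
    have := fg z; have : - f z <= Num.max (- f z) 0 by rewrite le_max lexx.
    lra.
rewrite ge0_integralD//; first last.
- exact/measurable_EFinP.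
- by move=> z _; rewrite lee_fin.
- exact: measurable_funeneg.
rewrite (_ : 2 * G - F = (G - F) + G); last by ring.
by rewrite EFinD leeD.
Qed.

Section nonlocal.
Context {R : realType} {N : nat}.
Local Notation mu := (rV_lebesgue R N).
Local Notation mu2 := (mu \x mu)%E.
Implicit Types (p q : R) (u w phi : 'rV[R]_N -> R) (U B : set 'rV[R]_N).

Lemma ae_prod (P : 'rV[R]_N -> Prop) : {ae mu, forall x, P x} ->
  {ae mu2, forall z, P z.1 /\ P z.2}.
Proof.
move=> [A [mA A0 PA]].
have m1 : measurable (A `*` setT : set ('rV[R]_N * 'rV[R]_N)) by exact: measurableX.
have m2 : measurable (setT `*` A : set ('rV[R]_N * 'rV[R]_N)) by exact: measurableX.
exists (A `*` setT `|` setT `*` A); split.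
- exact: measurableU.
- apply/eqP; rewrite -measure_le0.
  apply: (le_trans (measureU2 _ _ _)) => //.
  have E1 : mu2 (A `*` setT) = 0%E by rewrite product_measure1E// [X in (X * _)%E]A0 mul0e.
  have E2 : mu2 (setT `*` A) = 0%E by rewrite product_measure1E// [X in (_ * X)%E]A0 mule0.
  by rewrite [X in (X + _)%E]E1 [X in (_ + X)%E]E2 adde0.
- move=> z /= /not_andP[nP|nP]; [left|right]; split => //=; exact: PA.
Qed.

Lemma measurable_spow p : measurable_fun setT (spow p : R -> R).
Proof.
apply: measurable_funM => //; apply: (measurableT_comp (measurable_powR _)).
exact: normr_measurable.
Qed.

Lemma measurable_diff u : measurable_fun setT u ->
  measurable_fun setT (fun z : 'rV[R]_N * 'rV[R]_N => u z.1 - u z.2).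
Proof.
move=> meas_u; apply: measurable_funB; first exact: measurableT_comp.
exact: measurableT_comp.
Qed.

Lemma measurable_fracplap_integrand p q u phi :
  measurable_fun setT u -> measurable_fun setT phi ->
  measurable_fun setT (fun z : 'rV[R]_N * 'rV[R]_N =>
    spow p (u z.1 - u z.2) * (phi z.1 - phi z.2) / enorm (z.1 - z.2) `^ q).
Proof.
move=> meas_u mphi; apply: measurable_funM; last first.
  exact: (measurable_inv_enorm_powR q measurable_fst measurable_snd).
apply: measurable_funM; last exact: measurable_diff.
by apply: (measurableT_comp (measurable_spow p)); exact: measurable_diff.
Qed.

Lemma measurable_gagliardo_integrand p q u : measurable_fun setT u ->
  measurable_fun setT (fun z : 'rV[R]_N * 'rV[R]_N =>
    `|u z.1 - u z.2| `^ p / enorm (z.1 - z.2) `^ q).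
Proof.
move=> meas_u; apply: measurable_funM; last first.
  exact: (measurable_inv_enorm_powR q measurable_fst measurable_snd).
apply: (measurableT_comp (measurable_powR _)).
by apply: (measurableT_comp (@normr_measurable _ _)); exact: measurable_diff.
Qed.

(** Lets [u] be replaced by a representative with a sign everywhere. *)
Lemma fracplap_form_ae s p u w phi :
  measurable_fun setT u -> measurable_fun setT w -> measurable_fun setT phi ->
  {ae mu, forall x, u x = w x} ->
  fracplap_form s p u phi = fracplap_form s p w phi.
Proof.
move=> meas_u mw mphi /ae_prod uw; apply: ae_eq_integral => //.
- by apply/measurable_EFinP; exact: measurable_fracplap_integrand.
- by apply/measurable_EFinP; exact: measurable_fracplap_integrand.
by apply: filterS uw => z [-> ->].
Qed.

Lemma gagliardo_ae s p U u w : measurable U ->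
  measurable_fun setT u -> measurable_fun setT w ->
  {ae mu, forall x, u x = w x} -> gagliardo s p U u = gagliardo s p U w.
Proof.
move=> mU meas_u mw /ae_prod uw; apply: ae_eq_integral => //.
- exact: measurableX.
- apply: (measurable_funS measurableT) => //.
  by apply/measurable_EFinP; exact: measurable_gagliardo_integrand.
- apply: (measurable_funS measurableT) => //.
  by apply/measurable_EFinP; exact: measurable_gagliardo_integrand.
by apply: filterS uw => z [-> ->].
Qed.

(** The kernel after one has used that the numerator vanishes like [|x - y| ^ p] on
    the diagonal and is bounded. *)
Definition trunc_kernel p q (z : 'rV[R]_N * 'rV[R]_N) : R :=
  Num.min 1 `|z.1 - z.2| `^ p / enorm (z.1 - z.2) `^ q.

Lemma trunc_kernel_ge0 p q z : 0 <= trunc_kernel p q z.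
Proof. by rewrite divr_ge0 ?powR_ge0. Qed.

Lemma measurable_trunc_kernel p q : measurable_fun setT (trunc_kernel p q).
Proof.
apply: measurable_funM; last exact: (measurable_inv_enorm_powR q measurable_fst measurable_snd).
apply: (measurableT_comp (measurable_powR _)); apply: measurable_minr => //.
by apply: (measurableT_comp measurable_rV_norm); exact: (measurable_rV_sub measurable_fst measurable_snd).
Qed.

(** Each of the two variables in turn is integrated over the whole space, and
    the other one over [B]. *)
Lemma integral_trunc_kernel_le p q : N%:R < q -> q < N%:R + p ->
  exists2 K : R, 0 <= K & forall B, measurable B ->
    (\int[mu2]_z ((\1_B z.1 + \1_B z.2) * trunc_kernel p q z)%:E <= K%:E * mu B)%E.
Proof.
move=> Nq qNp; have [K K0 HK] := integral_kernel_le Nq qNp.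
exists (K + K); first by rewrite addr_ge0.
move=> B mB.
have mI : measurable_fun setT (\1_B : 'rV[R]_N -> R) by exact: measurable_indic.
have mk := measurable_trunc_kernel p q.
pose f1 (z : 'rV[R]_N * 'rV[R]_N) := ((\1_B z.1 : R) * trunc_kernel p q z)%:E.
pose f2 (z : 'rV[R]_N * 'rV[R]_N) := ((\1_B z.2 : R) * trunc_kernel p q z)%:E.
have mf1 : measurable_fun setT f1.
  by apply/measurable_EFinP; apply: measurable_funM => //; exact: measurableT_comp.
have mf2 : measurable_fun setT f2.
  by apply/measurable_EFinP; apply: measurable_funM => //; exact: measurableT_comp.
have f10 z : (0 <= f1 z)%E by rewrite lee_fin mulr_ge0 ?trunc_kernel_ge0.
have f20 z : (0 <= f2 z)%E by rewrite lee_fin mulr_ge0 ?trunc_kernel_ge0.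
rewrite [leLHS](_ : _ = \int[mu2]_z f1 z + \int[mu2]_z f2 z)%E; last first.
  rewrite -ge0_integralD//.
  by apply: eq_integral => z _; rewrite /f1 /f2 mulrDl EFinD.
rewrite EFinD ge0_muleDl ?lee_fin//.
have IB : (\int[mu]_x (K%:E * (\1_B x)%:E) = K%:E * mu B)%E.
  rewrite ge0_integralZl_EFin//; last exact/measurable_EFinP.
  by rewrite integral_indic// setIT.
apply: leeD.
- rewrite fubini_tonelli1// -IB; apply: ge0_le_integral => //.
  + by move=> x _; apply: integral_ge0.
  + exact: measurable_fun_fubini_tonelli_F.
  + by apply: measurable_funeM; exact/measurable_EFinP.
  + move=> x _; rewrite /fubini_F /f1 /=.
    under eq_integral do rewrite EFinM.
    rewrite ge0_integralZl_EFin//; last 2 first.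
    * by move=> y _; rewrite lee_fin trunc_kernel_ge0.
    * by apply/measurable_EFinP; apply: (measurableT_comp mk); exact: measurable_pair1.
    by rewrite muleC lee_wpmul2r ?lee_fin// HK.
- rewrite fubini_tonelli2// -IB; apply: ge0_le_integral => //.
  + by move=> x _; apply: integral_ge0.
  + exact: measurable_fun_fubini_tonelli_G.
  + by apply: measurable_funeM; exact/measurable_EFinP.
  + move=> x _; rewrite /fubini_G /f2 /=.
    under eq_integral do rewrite EFinM.
    rewrite ge0_integralZl_EFin//; last 2 first.
    * by move=> y _; rewrite lee_fin trunc_kernel_ge0.
    * by apply/measurable_EFinP; apply: (measurableT_comp mk); exact: measurable_pair2.
    rewrite muleC lee_wpmul2r ?lee_fin//.
    under eq_integral do rewrite /trunc_kernel /= distrC enormB.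
    exact: HK.
Qed.

End nonlocal.

(** * Representatives and test functions *)

Section representatives.
Context {R : realType} {N : nat}.
Local Notation mu := (rV_lebesgue R N).
Implicit Types (u : 'rV[R]_N -> R) (Omega : set 'rV[R]_N).

Lemma closed_norm_le (r : R) : closed [set x : 'rV[R]_N | `|x| <= r].
Proof.
apply: (@closed_comp _ _ (fun x : 'rV[R]_N => `|x|) [set x | x <= r]).
  by move=> x _; exact: norm_continuous.
exact: closed_le.
Qed.

Lemma bounded_norm_le (r : R) (A : set 'rV[R]_N) :
  (forall x, A x -> `|x| <= r) -> bounded_set A.
Proof.
move=> Ar; exists r; split; first exact: num_real.
by move=> M rM x Ax /=; apply: (le_trans (Ar x Ax)); exact: ltW.
Qed.

Lemma compact_norm_le (r : R) : compact [set x : 'rV[R]_N | `|x| <= r].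
Proof.
apply: bounded_closed_compact; last exact: closed_norm_le.
exact: (@bounded_norm_le r).
Qed.

(** Balls exhaust the space and are compact, so that measurability on compact sets
    is enough. *)
Lemma memLp_loc_measurable (p : R) u : memLp_loc p u -> measurable_fun setT u.
Proof.
move=> Lu _ Y mY; rewrite setTI.
pose K (n : nat) := [set x : 'rV[R]_N | `|x| <= n%:R].
have -> : u @^-1` Y = \bigcup_n (K n `&` (u \_ (K n)) @^-1` Y).
  apply/seteqP; split => x /=.
    move=> Yx; exists (Num.bound `|x|) => //.
    have xK : K (Num.bound `|x|) x by rewrite /K /= ltW// archi_boundP.
    by split => //=; rewrite patchE mem_set.
  by move=> [n _ [Kx /=]]; rewrite patchE mem_set.
apply: bigcup_measurable => n _; apply: measurableI.
  by apply: rV_closed_measurable; exact: closed_norm_le.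
have /sub_Lfun_mfun := Lu _ (@compact_norm_le n%:R).
by rewrite inE => /= mf; rewrite -[X in measurable X]setTI; exact: mf.
Qed.

Lemma ae_exists_in_ball (P : 'rV[R]_N -> Prop) x r : 0 < r ->
  {ae mu, forall y, P y} -> exists2 y, ball x r y & P y.
Proof.
move=> r0 [A [mA A0 PA]]; apply: contrapT => nP.
have : (mu (ball x r) <= mu A)%E.
  apply: le_measure; rewrite ?inE//; first exact: measurable_rV_ball.
  by move=> y xy; apply: PA => /= Py; apply: nP; exists y.
by rewrite [leRHS]A0 rV_lebesgue_ball// lee_fin leNgt exprn_gt0 ?mulr_gt0.
Qed.

Lemma continuous_closure_open u Omega x : open Omega ->
  {within closure Omega, continuous u} -> Omega x -> {for x, continuous u}.
Proof.
move=> oO cu Ox; have := continuous_subspaceW (@subset_closure _ Omega) cu.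
by rewrite continuous_open_subspace// => /(_ x (mem_set Ox)).
Qed.

Lemma ae_ge0_continuous u Omega : open Omega ->
  {within closure Omega, continuous u} ->
  {ae mu, forall x, 0 <= u x} -> forall x, Omega x -> 0 <= u x.
Proof.
move=> oO cu u0 x Ox; rewrite leNgt; apply/negP => ux.
have := continuous_closure_open oO cu Ox => /(cvgr_lt (u x)) /(_ _ ux).
move=> /nbhs_ballP[r /= r0 ur].
have [y /ur /=] := ae_exists_in_ball x r0 u0.
by move=> /lt_le_trans /[apply]; rewrite ltxx.
Qed.

End representatives.

Section Wtilde_criterion.
Context {R : realType} {N : nat} (s p : R).
Hypotheses (s_gt0 : 0 < s) (s_lt1 : s < 1) (p_gt1 : 1 < p).
Local Notation mu := (rV_lebesgue R N).
Local Notation mu2 := (mu \x mu)%E.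
Local Notation q := (N%:R + s * p).
Implicit Types (w phi : 'rV[R]_N -> R) (U B Omega : set 'rV[R]_N).

Lemma bounded_support_memLp phi B M : measurable_fun setT phi ->
  measurable B -> (mu B < +oo)%E -> 0 <= M ->
  (forall x, `|phi x| <= M) -> (forall x, ~ B x -> phi x = 0) ->
  phi \in Lfun mu p%:E.
Proof.
move=> mphi mB Boo M0 phiM phi0; have p1 := p_gt1; have p0 : 0 < p by lra.
rewrite inE; apply/andP; split; rewrite inE//=.
rewrite /finite_norm unlock /=; apply: poweR_lty.
apply: (@le_lt_trans _ _ (\int[mu]_x ((M `^ p)%:E * (\1_B x)%:E))%E).
  apply: ge0_le_integral => //.
  - apply/measurable_EFinP; apply: (measurableT_comp (measurable_powR _)).
    by apply: (measurableT_comp (@normr_measurable _ _)).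
  - by apply: measurable_funeM; apply/measurable_EFinP; exact: measurable_indic.
  - move=> x _ /=; rewrite -EFinM lee_fin indicE.
    have [Bx|Bx] := pselect (B x).
      by rewrite mem_set// mulr1 ge0_ler_powR ?nnegrE// ltW.
    by rewrite memNset// mulr0 phi0// normr0 powR0// gt_eqF.
rewrite ge0_integralZl_EFin ?powR_ge0//; last first.
  by apply/measurable_EFinP; exact: measurable_indic.
by rewrite integral_indic// setIT lte_mul_pinfty// lee_fin powR_ge0.
Qed.

Lemma powR_add_le (a b : R) : 0 <= a -> 0 <= b ->
  (a + b) `^ p <= 2 `^ p * a `^ p + 2 `^ p * b `^ p.
Proof.
have p1 := p_gt1; move=> a0 b0; have p0 : 0 <= p by lra.
wlog ab : a b a0 b0 / a <= b.
  move=> H; have [ab|ba] := leP a b; first exact: H.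
  by rewrite addrC [leRHS]addrC; apply: H => //; exact: ltW.
apply: (@le_trans _ _ (2 `^ p * b `^ p)).
  by rewrite -powRM// ge0_ler_powR ?nnegrE//; lra.
by rewrite lerDr mulr_ge0 ?powR_ge0.
Qed.

(** Extension by zero is harmless here: two points one of which is outside [U] interact
    only at distance at least [del], where the kernel is integrable. Inside [U], the
    increments of [phi] are those of a function of finite energy, up to a Lipschitz
    error that the kernel tolerates because [s < 1]. *)
Lemma Wtilde_of_increments Omega U B w phi M L del :
  measurable Omega -> measurable U -> measurable B ->
  measurable_fun setT w -> measurable_fun setT phi -> B `<=` Omega ->
  (mu B < +oo)%E -> 0 <= M -> 0 <= L -> 0 < del <= 1 ->
  (forall x, `|phi x| <= M) -> (forall x, ~ B x -> phi x = 0) ->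
  (forall x y, B x -> ~ U y -> del <= `|x - y|) ->
  (forall x y, U x -> U y ->
    `|phi x - phi y| <= `|w x - w y| + L * Num.min 1 `|x - y|) ->
  (gagliardo s p U w < +oo)%E ->
  Wtilde s p Omega phi.
Proof.
move=> mO mU mB mw mphi BO Boo M0 L0 /andP[del0 del1] phiM phi0 sep incr wU.
have p1 := p_gt1; have p0 : 0 < p by lra.
have sp0 : 0 < s * p by rewrite mulr_gt0.
have spp : s * p < p by rewrite -[ltRHS]mul1r ltr_pM2r.
have patchO : phi \_ Omega = phi.
  apply/funext => x; rewrite patchE; case: ifPn => // /negP Ox.
  by rewrite phi0// => /BO Bx; apply: Ox; exact: mem_set.
have Lphi := bounded_support_memLp mphi mB Boo M0 phiM phi0.
pose C := 2 `^ p * L `^ p + (M / del) `^ p.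
have C0 : 0 <= C by rewrite addr_ge0 ?mulr_ge0 ?powR_ge0.
have pointwise x y : `|phi x - phi y| `^ p <=
    2 `^ p * (\1_(U `*` U) (x, y) * `|w x - w y| `^ p) +
    C * (\1_B x + \1_B y) * Num.min 1 `|x - y| `^ p.
  have r0 : 0 <= 2 `^ p * (\1_(U `*` U) (x, y) * `|w x - w y| `^ p).
    by rewrite !mulr_ge0 ?powR_ge0.
  have m0 : 0 <= Num.min 1 `|x - y| by rewrite le_min ler01 normr_ge0.
  have BU z : B z -> U z.
    move=> Bz; apply: contrapT => Uz; have := sep _ _ Bz Uz.
    by rewrite subrr normr0 leNgt del0.
  (* Between a point of B and a point outside U the increment is at most M, whereas
     the truncated distance is at least del. *)
  have outside x' y' : B x' -> ~ U y' -> `|phi x' - phi y'| `^ p <=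
      C * Num.min 1 `|x' - y'| `^ p.
    move=> Bx' Uy'; rewrite (phi0 y') ?subr0; last by move/BU.
    apply: (@le_trans _ _ ((M / del) `^ p * Num.min 1 `|x' - y'| `^ p)); last first.
      by rewrite ler_wpM2r ?powR_ge0// lerDr mulr_ge0 ?powR_ge0.
    have d0 : 0 <= M / del by rewrite divr_ge0// ltW.
    have mm : del <= Num.min 1 `|x' - y'| by rewrite le_min del1 sep.
    have mm0 : 0 <= Num.min 1 `|x' - y'| by rewrite (le_trans _ mm)// ltW.
    have phi_le : `|phi x'| <= M / del * Num.min 1 `|x' - y'|.
      apply: (le_trans (phiM x')); rewrite -[leLHS](divfK (lt0r_neq0 del0)).
      by rewrite ler_wpM2l.
    by rewrite -powRM// ge0_ler_powR ?nnegrE ?(ltW p0)// mulr_ge0.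
  have [Bxy|nB] := pselect (B x \/ B y); last first.
    have [Bx By] : ~ B x /\ ~ B y by exact/not_orP.
    rewrite !phi0// subrr normr0 powR0 ?gt_eqF//; apply: addr_ge0 => //.
    by apply: mulr_ge0; rewrite ?powR_ge0//; apply: mulr_ge0 => //; exact: addr_ge0.
  have ind1 : 1 <= \1_B x + \1_B y :> R.
    rewrite !indicE; case: Bxy => /mem_set ->; first by rewrite lerDl.
    by rewrite lerDr.
  have le1 : C * Num.min 1 `|x - y| `^ p <=
      C * (\1_B x + \1_B y) * Num.min 1 `|x - y| `^ p.
    by rewrite ler_wpM2r ?powR_ge0// ler_peMr.
  have [Ux|Ux] := pselect (U x); last first.
    have Bx : ~ B x by move/BU.
    have {Bxy}By : B y by case: Bxy.
    apply: (@le_trans _ _ (C * Num.min 1 `|x - y| `^ p)); last by lra.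
    by rewrite distrC [`|x - y|]distrC; exact: outside.
  have [Uy|Uy] := pselect (U y); last first.
    have By : ~ B y by move/BU.
    have {Bxy}Bx : B x by case: Bxy.
    by apply: (@le_trans _ _ (C * Num.min 1 `|x - y| `^ p)); [exact: outside|lra].
  have := powR_add_le (normr_ge0 (w x - w y)) (mulr_ge0 L0 m0).
  have i1 : `|phi x - phi y| `^ p <= (`|w x - w y| + L * Num.min 1 `|x - y|) `^ p.
    by rewrite ge0_ler_powR ?nnegrE ?(ltW p0)// ?incr// addr_ge0// mulr_ge0.
  move/(le_trans i1) => {}i1; apply: (le_trans i1).
  rewrite indicE mem_set// mul1r lerD2l powRM// mulrA; apply: le_trans le1.
  by rewrite ler_wpM2r ?powR_ge0// lerDl powR_ge0.
have Nq : N%:R < q by lra.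
have qNp : q < N%:R + p by lra.
have [K K0 HK] := integral_trunc_kernel_le Nq qNp.
have mUU : measurable (U `*` U) by exact: measurableX.
have mI : measurable_fun setT (\1_B : 'rV[R]_N -> R) by exact: measurable_indic.
pose h1 (z : 'rV[R]_N * 'rV[R]_N) :=
  ((\1_(U `*` U) z : R) * (`|w z.1 - w z.2| `^ p / enorm (z.1 - z.2) `^ q))%:E.
pose h2 (z : 'rV[R]_N * 'rV[R]_N) :=
  (((\1_B z.1 + \1_B z.2) : R) * trunc_kernel p q z)%:E.
have mh1 : measurable_fun setT h1.
  apply/measurable_EFinP; apply: measurable_funM; last first.
    exact: measurable_gagliardo_integrand.
  exact: measurable_indic.
have mh2 : measurable_fun setT h2.
  apply/measurable_EFinP; apply: measurable_funM; last exact: measurable_trunc_kernel.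
  by apply: measurable_funD; exact: measurableT_comp.
have h10 z : (0 <= h1 z)%E by rewrite lee_fin mulr_ge0 ?divr_ge0 ?powR_ge0.
have h20 z : (0 <= h2 z)%E.
  by rewrite lee_fin mulr_ge0 ?trunc_kernel_ge0// addr_ge0.
have gT : (gagliardo s p setT phi < +oo)%E.
  rewrite /gagliardo setXTT.
  apply: (@le_lt_trans _ _ (\int[mu2]_z ((2 `^ p)%:E * h1 z + C%:E * h2 z))%E).
    apply: ge0_le_integral => //.
    - by move=> z _; rewrite lee_fin divr_ge0 ?powR_ge0.
    - by apply/measurable_EFinP; exact: measurable_gagliardo_integrand.
    - by apply: emeasurable_funD; exact: measurable_funeM.
    - move=> [x y] _; rewrite -!EFinM -EFinD lee_fin /=.
      rewrite /trunc_kernel /= !mulrA -mulrDl ler_wpM2r ?invr_ge0 ?powR_ge0//.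
      by have := pointwise x y; rewrite !mulrA.
  rewrite ge0_integralD//; first last.
  - exact: measurable_funeM.
  - by move=> z _; rewrite mule_ge0// lee_fin.
  - exact: measurable_funeM.
  - by move=> z _; rewrite mule_ge0// lee_fin powR_ge0.
  rewrite !ge0_integralZl_EFin ?powR_ge0//.
  rewrite lte_add_pinfty// lte_mul_pinfty ?lee_fin ?powR_ge0//.
    rewrite (_ : \int[mu2]_z h1 z = gagliardo s p U w)%E// /gagliardo.
    rewrite [RHS]integral_mkcond; apply: eq_integral => z _.
    rewrite patchE /h1 indicE; case: ifP => zU; first by rewrite mul1r.
    by rewrite mul0r.
  apply: (le_lt_trans (HK _ mB)).
  by rewrite lte_mul_pinfty// lee_fin.
split; last exact: patchO.
- split; first by rewrite /memLp patchO.
  apply: le_lt_trans gT; apply: ge0_subset_integral => //.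
  + exact: measurableX.
  + by rewrite setXTT.
  + by rewrite setXTT; apply/measurable_EFinP; exact: measurable_gagliardo_integrand.
  + by move=> z _; rewrite lee_fin divr_ge0 ?powR_ge0.
- by rewrite patchO; split => //; rewrite /memLp patch_setT.
Qed.

End Wtilde_criterion.

(** * The level set estimate *)

Section cutoff.
Context {R : realType} {N : nat} (x0 : 'rV[R]_N) (r1 r2 : R).
Hypothesis r12 : r1 < r2.

Definition cutoff (x : 'rV[R]_N) : R :=
  Num.max 0 (Num.min 1 ((r2 - `|x0 - x|) / (r2 - r1))).

Lemma cutoff_ge0 x : 0 <= cutoff x.
Proof. by rewrite le_max lexx. Qed.

Lemma cutoff_le1 x : cutoff x <= 1.
Proof. by rewrite ge_max ler01 ge_min lexx. Qed.

Lemma cutoff_in x : ball x0 r1 x -> cutoff x = 1.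
Proof.
rewrite rV_ballE /= => xr; have := r12 => r12'.
rewrite /cutoff min_l ?max_r//; rewrite ler_pdivlMr ?subr_gt0//; lra.
Qed.

Lemma cutoff_out x : ~ ball x0 r2 x -> cutoff x = 0.
Proof.
rewrite rV_ballE /= => /negP; rewrite -leNgt => xr; have := r12 => r12'.
rewrite /cutoff max_l// ge_min; apply/orP; right.
by rewrite mulr_le0_ge0 ?subr_le0// invr_ge0 subr_ge0 ltW.
Qed.

Lemma cutoff_lipschitz x y : r2 - r1 <= 1 ->
  `|cutoff x - cutoff y| <= (r2 - r1)^-1 * Num.min 1 `|x - y|.
Proof.
move=> r12_1; have d0 : 0 < r2 - r1 by rewrite subr_gt0.
wlog xy : x y / cutoff y <= cutoff x.
  move=> H; have [yx|xy] := leP (cutoff y) (cutoff x); first exact: H.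
  by rewrite distrC [`|x - y|]distrC; apply: H; exact: ltW.
rewrite ger0_norm ?subr_ge0// mulrC ler_pdivlMr// le_min; apply/andP; split.
  have c1 := cutoff_le1 x; have c2 := cutoff_ge0 y.
  rewrite mulr_ile1 ?subr_ge0 ?(ltW d0)//; lra.
rewrite mulrBl lerBlDr.
have tri : `|x0 - y| <= `|x0 - x| + `|x - y|.
  by rewrite (le_trans _ (ler_normD _ _))// subrKA.
have cy : Num.min (r2 - r1) (r2 - `|x0 - y|) <= cutoff y * (r2 - r1).
  rewrite -ler_pdivrMr// /cutoff le_max; apply/orP; right.
  rewrite le_min; apply/andP; split; rewrite ler_pdivrMr// ?mul1r ?divfK ?gt_eqF//;
    by rewrite ge_min lexx ?orbT.
have cy0 : 0 <= cutoff y * (r2 - r1) by rewrite mulr_ge0 ?cutoff_ge0// ltW.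
have n0 := normr_ge0 (x - y).
rewrite -ler_pdivlMr// [cutoff x]/cutoff ge_max; apply/andP; split.
  by rewrite divr_ge0 ?(ltW d0)// addr_ge0.
have [h|h] := leP (r2 - r1) (r2 - `|x0 - y|).
  rewrite (min_l h) in cy.
  rewrite ge_min ler_pdivlMr// mul1r; apply/orP; left; lra.
rewrite (min_r (ltW h)) in cy.
rewrite ge_min; apply/orP; right; rewrite ler_pM2r ?invr_gt0//; lra.
Qed.

Lemma measurable_cutoff : measurable_fun setT cutoff.
Proof.
apply: measurable_maxr => //; apply: measurable_minr => //.
apply: measurable_funM => //; apply: measurable_funB => //.
by apply: (measurableT_comp measurable_rV_norm); exact: measurable_rV_sub.
Qed.

End cutoff.

Section sublevels.
Context {R : realType} {N : nat} (u : 'rV[R]_N -> R) (x0 : 'rV[R]_N).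
Hypothesis meas_u : measurable_fun setT u.
Local Notation mu := (rV_lebesgue R N).

Definition sublevel (k r : R) : set 'rV[R]_N := [set x | u x < k] `&` ball x0 r.

Lemma measurable_lt_set k : measurable [set x | u x < k].
Proof.
rewrite -[X in measurable X]setTI.
rewrite (_ : [set x | _] = u @^-1` [set` `]-oo, k[]); last first.
  by apply/seteqP; split => x /=; rewrite in_itv.
exact: meas_u.
Qed.

Lemma measurable_sublevel k r : measurable (sublevel k r).
Proof. by apply: measurableI; [exact: measurable_lt_set|exact: measurable_rV_ball]. Qed.

Lemma sublevel_fin_num k r : 0 < r -> mu (sublevel k r) \is a fin_num.
Proof.
move=> r_gt0; rewrite ge0_fin_numE//.
apply: (@le_lt_trans _ _ (mu (ball x0 r))); last by rewrite rV_lebesgue_ball// ltry.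
apply: le_measure; rewrite ?inE//; last by move=> x [].
  exact: measurable_sublevel.
exact: measurable_rV_ball.
Qed.

(** The estimate to be iterated; [G] is a lower bound for the kernel mass, weighted by
    the height, that the points of the smaller sublevel set see above the level
    [k]. *)
Definition level_set_growth (s p r0 C : R) := forall k l r1 r2 G : R,
  0 < k -> l < k -> 0 < r1 -> r1 < r2 -> r2 < r0 -> 0 <= G ->
  (forall x, sublevel l r1 x -> (G%:E <= \int[mu]_y
     (\1_(~` [set y | (u y < k)%R]) y * (u y - u x) `^ (p - 1) /
        enorm (x - y) `^ (N%:R + s * p))%:E)%E) ->
  (k - l) * G * fine (mu (sublevel l r1)) <=
    C * k `^ p * (r2 - r1)^-1 `^ p * fine (mu (sublevel k r2)).

End sublevels.

Section growth.
Context {R : realType} {N : nat} (s p : R).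
Hypotheses (s_gt0 : 0 < s) (s_lt1 : s < 1) (p_gt1 : 1 < p).
Local Notation mu := (rV_lebesgue R N).
Local Notation mu2 := (mu \x mu)%E.
Local Notation q := (N%:R + s * p).
Variables (u : 'rV[R]_N -> R) (x0 : 'rV[R]_N) (r0 : R).
Variables (U Omega : set 'rV[R]_N) (F : ('rV[R]_N -> R) -> R) (M : R).
Hypotheses (r0_le1 : r0 <= 1) (meas_u : measurable_fun setT u).
Hypotheses (u_ge0 : forall x, 0 <= u x) (M_ge0 : 0 <= M).
Hypotheses (mU : measurable U) (mO : measurable Omega).
Hypotheses (ballU : ball x0 r0 `<=` U) (ballO : ball x0 r0 `<=` Omega).
Hypothesis u_energy : (gagliardo s p U u < +oo)%E.
Hypothesis u_super : forall phi, Wtilde s p Omega phi -> (forall x, 0 <= phi x) ->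
  ((F phi)%:E <= fracplap_form s p u phi)%E.
(** [F] stands for the pairing with the zero order term, which is of order at most
    [k ^ (p - 1)] where [u <= k]. *)
Hypothesis F_ge : forall (k : R) (phi : 'rV[R]_N -> R) (E : set 'rV[R]_N),
  0 < k -> measurable_fun setT phi -> measurable E ->
  E `<=` ball x0 r0 -> (forall x, E x -> u x <= k) ->
  (forall x, 0 <= phi x) -> (forall x, phi x <= k * \1_E x) ->
  - (M * k `^ p * fine (mu E)) <= F phi.

Local Notation sublevel := (sublevel u x0).

Definition test_fun (k r1 r2 : R) (x : 'rV[R]_N) : R :=
  Num.max 0 (k - u x) * cutoff x0 r1 r2 x `^ p.

Lemma test_fun_ge0 k r1 r2 x : 0 <= test_fun k r1 r2 x.
Proof. by rewrite mulr_ge0 ?powR_ge0// le_max lexx. Qed.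

Lemma measurable_test_fun k r1 r2 : measurable_fun setT (test_fun k r1 r2).
Proof.
apply: measurable_funM.
  by apply: measurable_maxr => //; exact: measurable_funB.
by apply: (measurableT_comp (measurable_powR _)); exact: measurable_cutoff.
Qed.

Lemma test_fun_le k r1 r2 x : 0 < k -> r1 < r2 ->
  test_fun k r1 r2 x <= k * \1_(sublevel k r2) x.
Proof.
move=> k0 r12; have p1 := p_gt1; rewrite indicE.
have [[uk Bx]|nE] := pselect (sublevel k r2 x).
  rewrite mem_set//; apply: ler_pM; rewrite ?le_max ?lexx ?powR_ge0//.
    by rewrite ge_max (ltW k0) gerBl u_ge0.
  apply: (@le_trans _ _ (1 `^ p)); last by rewrite powR1.
  rewrite ge0_ler_powR ?nnegrE ?cutoff_ge0 ?cutoff_le1//; lra.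
rewrite memNset// mulr0 /test_fun.
have [uk|uk] := ltP (u x) k; last by rewrite max_l ?mul0r// subr_le0.
rewrite cutoff_out// ?powR0 ?mulr0//; last by move=> Bx; apply: nE.
by rewrite gt_eqF; lra.
Qed.

(** The increments of the test function are those of [u], up to a Lipschitz term due
    to the cut-off: truncation is 1-Lipschitz, and both factors are bounded. *)
Lemma test_fun_Wtilde k r1 r2 : 0 < k -> r1 < r2 -> r2 - r1 <= 1 -> 0 < r2 < r0 ->
  Wtilde s p Omega (test_fun k r1 r2).
Proof.
move=> k0 r12 r12_1 /andP[r2_gt0 r20]; have p1 := p_gt1.
have r20B : ball x0 r2 `<=` ball x0 r0 by apply: le_ball; exact: ltW.
have le1 := @test_fun_le k r1 r2 _ k0 r12.
apply: (@Wtilde_of_increments _ _ _ _ s_gt0 s_lt1 p_gt1 _ U (ball x0 r2) u _ k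
  (k * (p * (r2 - r1)^-1)) (Num.min 1 (r0 - r2))) => //.
- exact: measurable_rV_ball.
- exact: measurable_test_fun.
- exact: subset_trans r20B ballO.
- by rewrite rV_lebesgue_ball// ltry.
- exact: ltW.
- by rewrite mulr_ge0 ?mulr_ge0 ?invr_ge0 ?subr_ge0// ltW//; lra.
- by rewrite lt_min ltr01 subr_gt0 r20 ge_min lexx.
- move=> x; rewrite ger0_norm ?test_fun_ge0//; apply: (le_trans (le1 x)).
  by rewrite ler_piMr ?(ltW k0)// indicE lern1 leq_b1.
- move=> x Bx; apply/eqP; rewrite eq_le test_fun_ge0 andbT.
  by apply: (le_trans (le1 x)); rewrite indicE memNset ?mulr0// => -[].
- move=> x y; rewrite rV_ballE /= => xr Uy.
  have : ~ ball x0 r0 y by move/ballU.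
  rewrite rV_ballE /= => /negP; rewrite -leNgt => yr; rewrite ge_min; apply/orP; right.
  have : `|x0 - y| <= `|x0 - x| + `|x - y|.
    by rewrite (le_trans _ (ler_normD _ _))// subrKA.
  by move: yr xr; lra.
- move=> x y _ _.
  set v := fun x => Num.max 0 (k - u x); set e := fun x => cutoff x0 r1 r2 x `^ p.
  rewrite (_ : _ - _ = (v x - v y) * e x + v y * (e x - e y)); last first.
    have prodB (a b c d : R) : a * c - b * d = (a - b) * c + b * (c - d) by ring.
    exact: prodB.
  apply: (le_trans (ler_normD _ _)); rewrite !normrM; apply: lerD.
    rewrite -[leRHS]mulr1; apply: ler_pM; rewrite ?normr_ge0//.
      rewrite /v; have [h1|h1] := leP 0 (k - u x); have [h2|h2] := leP 0 (k - u y).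
      * by rewrite distrC ler_norml; apply/andP; split;
          have := ler_norm (u x - u y); have := ler_norm (u y - u x);
          rewrite [`|u y - u x|]distrC; lra.
      * rewrite subr0 ger0_norm//; have := ler_norm (u y - u x).
        by rewrite distrC; lra.
      * rewrite sub0r normrN ger0_norm//; have := ler_norm (u x - u y); lra.
      * by rewrite subrr normr0.
    rewrite /e ger0_norm ?powR_ge0//.
    apply: (@le_trans _ _ (1 `^ p)); last by rewrite powR1.
    rewrite ge0_ler_powR ?nnegrE ?cutoff_ge0 ?cutoff_le1//; lra.
  rewrite -mulrA; apply: ler_pM; rewrite ?normr_ge0//.
    rewrite /v ger0_norm ?le_max ?lexx// ge_max (ltW k0) gerBl; exact: u_ge0.
  rewrite -mulrA; apply: (le_trans (@powR_dist_le _ _ p_gt1 _ _ _ _)).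
  + by rewrite cutoff_ge0 cutoff_le1.
  + by rewrite cutoff_ge0 cutoff_le1.
  by rewrite ler_wpM2l ?cutoff_lipschitz//; lra.
Qed.

(** The constant of the level set estimate exists because the error terms of the
    Caccioppoli inequality only see pairs of points both below the level [k], one
    of them in the larger ball. In the proof, [g1] bounds the integrand for these
    pairs, and [g2] is what the pairs astride the level contribute with the good
    sign. *)
Lemma sublevel_growth : exists2 C : R, 0 < C & level_set_growth u x0 s p r0 C.
Proof.
have p1 := p_gt1; have p0 : 0 < p by lra.
have sp0 : 0 < s * p by rewrite mulr_gt0.
have spp : s * p < p by rewrite -[ltRHS]mul1r ltr_pM2r.
have Nq : N%:R < q by lra.
have qNp : q < N%:R + p by lra.
have [K K0 HK] := integral_trunc_kernel_le Nq qNp.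
have cc0 := @caccioppoli_cst_ge0 R p.
exists (2 * (caccioppoli_cst p * K) + M + 1).
  by rewrite ltr_wpDl// addr_ge0// !mulr_ge0.
move=> k l r1 r2 G k0 lk r1_gt0 r12 r2r0 G0 HG.
have r2_gt0 : 0 < r2 by lra.
have r12_1 : r2 - r1 <= 1 by have := r0_le1; lra.
have d0 : 0 < r2 - r1 by lra.
pose E := sublevel k r2; pose L := (r2 - r1)^-1 `^ p.
have mE : measurable E by exact: measurable_sublevel.
have L1 : 1 <= L.
  apply: (@le_trans _ _ (1 `^ p)); first by rewrite powR1.
  by rewrite ge0_ler_powR ?nnegrE ?(ltW p0)// ?invr_ge0 ?(ltW d0)// invf_ge1.
pose phi := test_fun k r1 r2; pose eta := cutoff x0 r1 r2.
have phi0 x : 0 <= phi x by exact: test_fun_ge0.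
have mphi : measurable_fun setT phi by exact: measurable_test_fun.
have Wphi : Wtilde s p Omega phi by apply: test_fun_Wtilde => //; rewrite r2_gt0.
pose c1 := caccioppoli_cst p * k `^ p * L.
have c10 : 0 <= c1 by rewrite !mulr_ge0 ?powR_ge0.
pose f (z : 'rV[R]_N * 'rV[R]_N) :=
  spow p (u z.1 - u z.2) * (phi z.1 - phi z.2) / enorm (z.1 - z.2) `^ q.
pose g1 (z : 'rV[R]_N * 'rV[R]_N) :=
  c1 * ((\1_E z.1 + \1_E z.2) * trunc_kernel p q z).
pose A := [set y | (u y < k)%R].
pose g2 (z : 'rV[R]_N * 'rV[R]_N) := \1_A z.1 * phi z.1 *
  (\1_(~` A) z.2 * (u z.2 - u z.1) `^ (p - 1) / enorm (z.1 - z.2) `^ q).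
have mA : measurable A by exact: measurable_lt_set.
have mI (D : set 'rV[R]_N) : measurable D -> measurable_fun setT (\1_D : 'rV[R]_N -> R).
  by move=> mD; exact: measurable_indic.
have mf : measurable_fun setT f by exact: measurable_fracplap_integrand.
have mh : measurable_fun setT (fun z => (\1_E z.1 + \1_E z.2) * trunc_kernel p q z).
  apply: measurable_funM; last exact: measurable_trunc_kernel.
  by apply: measurable_funD; apply: measurableT_comp => //; exact: mI.
have mg1 : measurable_fun setT g1 by exact: measurable_funM.
have minner : measurable_fun setT (fun z : 'rV[R]_N * 'rV[R]_N => \1_(~` A) z.2 *
    (u z.2 - u z.1) `^ (p - 1) / enorm (z.1 - z.2) `^ q).
  apply: measurable_funM; last first.
    exact: (measurable_inv_enorm_powR q measurable_fst measurable_snd).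
  apply: measurable_funM.
    by apply: measurableT_comp => //; apply: mI; exact: measurableC.
  apply: (measurableT_comp (measurable_powR _)).
  by apply: measurable_funB; exact: measurableT_comp.
have mg2 : measurable_fun setT g2.
  apply: measurable_funM minner; apply: measurable_funM; last exact: measurableT_comp.
  by apply: measurableT_comp => //; exact: mI.
have g10 z : 0 <= g1 z by rewrite mulr_ge0// mulr_ge0 ?trunc_kernel_ge0 ?addr_ge0.
have inner0 x y : 0 <= \1_(~` A) y * (u y - u x) `^ (p - 1) / enorm (x - y) `^ q :> R.
  by rewrite !mulr_ge0 ?invr_ge0 ?powR_ge0.
have g20 z : 0 <= g2 z by apply: mulr_ge0; [rewrite mulr_ge0|exact: inner0].
have phi_out x : k <= u x -> phi x = 0.
  by move=> ku; rewrite /phi /test_fun max_l ?mul0r// subr_le0.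
have fg z : f z + g2 z <= g1 z.
  case: z => x y; rewrite /f /g2 /=; set e := (enorm (x - y) `^ q)^-1.
  have e0 : 0 <= e by rewrite invr_ge0 powR_ge0.
  have [ux|ux] := ltP (u x) k; have [uy|uy] := ltP (u y) k.
  - rewrite [\1_(~` A) y]indicE memNset; last by move=> /(_ uy).
    rewrite !mul0r mulr0 addr0 /phi /test_fun !max_r ?subr_ge0 ?(ltW ux) ?(ltW uy)//.
    apply: (@le_trans _ _ (caccioppoli_cst p * (k `^ p * `|eta x - eta y| `^ p) * e)).
      rewrite ler_wpM2r//; apply: caccioppoli_pointwise; rewrite ?u_ge0 ?cutoff_ge0//;
        exact: ltW.
    rewrite /g1 /c1 /trunc_kernel /= -/e !mulrA ler_wpM2r// -!mulrA.
    rewrite ler_wpM2l// ler_wpM2l ?powR_ge0//.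
    have [Bxy|nB] := pselect (ball x0 r2 x \/ ball x0 r2 y); last first.
      have [Bx By] : ~ ball x0 r2 x /\ ~ ball x0 r2 y by exact/not_orP.
      rewrite /eta !cutoff_out// subrr normr0 powR0 ?gt_eqF//.
      by rewrite mulr_ge0 ?powR_ge0// mulr_ge0 ?powR_ge0// addr_ge0.
    have ind1 : 1 <= \1_E x + \1_E y :> R.
      rewrite !indicE; case: Bxy => B.
        by rewrite (@mem_set _ E x)// lerDl.
      by rewrite (@mem_set _ E y)// lerDr.
    apply: (@le_trans _ _ (L * Num.min 1 `|x - y| `^ p)).
      have m0 : 0 <= Num.min 1 `|x - y| by rewrite le_min ler01 normr_ge0.
      rewrite /L -powRM ?invr_ge0 ?(ltW d0)//.
      rewrite ge0_ler_powR ?nnegrE ?(ltW p0) ?normr_ge0 ?cutoff_lipschitz//.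
      by rewrite mulr_ge0// invr_ge0 ltW.
    by rewrite ler_wpM2l ?powR_ge0// ler_peMl ?powR_ge0.
  - rewrite [\1_A x]indicE [\1_(~` A) y]indicE !mem_set//=; last first.
      by apply/negP; rewrite -leNgt.
    rewrite (phi_out y)// subr0 !mul1r -opprB spowN spow_ge0E ?subr_ge0//; last first.
      by rewrite (le_trans (ltW ux)).
    rewrite (_ : _ + _ = 0); last by ring.
    exact: g10.
  - rewrite [\1_A x]indicE memNset ?mul0r ?addr0; last by apply/negP; rewrite -leNgt.
    rewrite (phi_out x)// sub0r mulrN.
    apply: (@le_trans _ _ 0); last exact: g10.
    rewrite mulNr oppr_le0 mulr_ge0// mulr_ge0// spow_ge0E ?powR_ge0// subr_ge0.
    by rewrite (le_trans (ltW uy)).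
  - rewrite [\1_A x]indicE memNset ?mul0r ?addr0; last by apply/negP; rewrite -leNgt.
    by rewrite (phi_out x)// (phi_out y)// subrr mulr0 mul0r.
have EB : E `<=` ball x0 r0.
  by move=> x [_]; apply: le_ball; exact: ltW.
have Fphi : - (M * k `^ p * fine (mu E)) <= F phi.
  apply: F_ge => //; first by move=> x [/ltW].
  by move=> x; exact: test_fun_le.
have finE : mu E \is a fin_num by exact: sublevel_fin_num.
have g1G : (\int[mu2]_z (g1 z)%:E <= (c1 * (K * fine (mu E)))%:E)%E.
  under eq_integral do rewrite EFinM.
  rewrite ge0_integralZl_EFin//; last 2 first.
  - by move=> z _; rewrite lee_fin mulr_ge0 ?trunc_kernel_ge0 ?addr_ge0.
  - exact/measurable_EFinP.
  by rewrite [leRHS]EFinM lee_wpmul2l ?lee_fin// [leRHS]EFinM fineK// HK.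
have := integral_absorb mf mg1 mg2 g10 g20 fg (u_super Wphi phi0) g1G.
have mg2e : measurable_fun setT (EFin \o g2) by exact/measurable_EFinP.
have g20e z : (0 <= (EFin \o g2) z)%E by rewrite lee_fin.
rewrite (fubini_tonelli1 _ mg2e g20e) => upper.
pose S := sublevel l r1.
have mS : measurable S by exact: measurable_sublevel.
have finS : mu S \is a fin_num by exact: sublevel_fin_num.
have lower : (((k - l) * G * fine (mu S))%:E <= \int[mu]_x fubini_F mu (EFin \o g2) x)%E.
  apply: (@le_trans _ _ (\int[mu]_x (((k - l) * G)%:E * (\1_S x)%:E))%E).
    rewrite ge0_integralZl_EFin ?mulr_ge0 ?subr_ge0 ?(ltW lk)//; last first.
      by apply/measurable_EFinP; exact: mI.
    by rewrite integral_indic// setIT EFinM fineK.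
  apply: ge0_le_integral => //.
  - by move=> x _; rewrite -EFinM lee_fin mulr_ge0// mulr_ge0// subr_ge0 ltW.
  - by apply: measurable_funeM; apply/measurable_EFinP; exact: mI.
  - exact: measurable_fun_fubini_tonelli_F.
  move=> x _; rewrite indicE; have [Sx|Sx] := pselect (S x); last first.
    by rewrite memNset// mule0 integral_ge0.
  rewrite mem_set// mule1 /fubini_F /=.
  have ux : u x < k by case: Sx => /= ul _; exact: lt_trans ul lk.
  under eq_integral do rewrite /g2 /= [\1_A x]indicE (mem_set (ux : A x)) mul1r EFinM.
  rewrite ge0_integralZl_EFin//; last 2 first.
  - by move=> y _; rewrite lee_fin.
  - by apply/measurable_EFinP; exact: (measurableT_comp minner (measurable_pair1 x)).
  rewrite EFinM; apply: lee_pmul; rewrite ?lee_fin ?subr_ge0 ?(ltW lk)//; last exact: HG.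
  case: Sx => /= ul Bx; rewrite /phi /test_fun cutoff_in// powR1 mulr1.
  by rewrite le_max lerD2l lerN2 (ltW ul) orbT.
have {upper lower} := le_trans lower upper; rewrite lee_fin => /le_trans; apply.
rewrite -/E -/L.
have m0 : 0 <= fine (mu E) by rewrite fine_ge0.
have kp0 : 0 <= k `^ p by exact: powR_ge0.
have MkL : M * k `^ p * fine (mu E) <= M * k `^ p * L * fine (mu E).
  by rewrite ler_wpM2r// ler_peMr// mulr_ge0.
have rest : 0 <= k `^ p * L * fine (mu E) by rewrite !mulr_ge0// powR_ge0.
rewrite /c1; nra.
Qed.

End growth.

(** * De Giorgi iteration *)

Section de_giorgi.
Context {R : realType} {N : nat} (s p : R).
Hypotheses (N_gt0 : (0 < N)%N) (s_gt0 : 0 < s) (s_lt1 : s < 1) (p_gt1 : 1 < p).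
Local Notation mu := (rV_lebesgue R N).
Local Notation q := (N%:R + s * p).
Variables (u : 'rV[R]_N -> R) (x0 : 'rV[R]_N) (r0 C : R).
Hypotheses (r0_gt0 : 0 < r0) (meas_u : measurable_fun setT u) (C_gt0 : 0 < C).
Hypothesis growth : level_set_growth u x0 s p r0 C.
Local Notation sublevel := (sublevel u x0).
Local Notation m := (fun k r => fine (mu (sublevel k r))).

(** The form in which the estimate is used: the mass above the level is provided by
    a set [S] on which the kernel and the height are bounded below. *)
Lemma level_set_growth_mass k l r1 r2 a D kap : 0 < k -> l < k -> 0 < r1 -> r1 < r2 ->
  r2 < r0 -> 0 < a -> 0 < D -> 0 <= kap ->
  (forall x, sublevel l r1 x -> exists S : set 'rV[R]_N, [/\ measurable S,
    (kap%:E <= mu S)%E &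
    forall y, S y -> [/\ k <= u y, a <= u y - u x & enorm (x - y) <= D]]) ->
  (k - l) * (a `^ (p - 1) / D `^ q * kap) * m l r1 <=
    C * k `^ p * (r2 - r1)^-1 `^ p * m k r2.
Proof.
move=> k0 lk r1_gt0 r12 r20 a0 D0 kap0 HS.
have p1 := p_gt1; have q0 : 0 < q.
  by rewrite ltr_wpDl// mulr_gt0//; lra.
apply: growth => //; first by rewrite !mulr_ge0 ?invr_ge0 ?powR_ge0.
move=> x /HS[S [mS kapS Sy]].
pose b := a `^ (p - 1) / D `^ q.
have b0 : 0 <= b by rewrite divr_ge0 ?powR_ge0.
apply: (@le_trans _ _ (\int[mu]_y (b%:E * (\1_S y)%:E))%E).
  rewrite ge0_integralZl_EFin//; last first.
    by apply/measurable_EFinP; exact: measurable_indic.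
  by rewrite integral_indic// setIT EFinM lee_wpmul2l// lee_fin.
apply: ge0_le_integral => //.
- by move=> y _; rewrite -EFinM lee_fin mulr_ge0.
- by apply: measurable_funeM; apply/measurable_EFinP; exact: measurable_indic.
- apply/measurable_EFinP; apply: measurable_funM; last first.
    exact: (measurable_inv_enorm_powR q (@measurable_cst _ _ _ _ _ x) (@measurable_id _ _ _)).
  apply: measurable_funM.
    by apply: measurable_indic; apply: measurableC; exact: measurable_lt_set.
  by apply: (measurableT_comp (measurable_powR _)); exact: measurable_funB.
move=> y _; rewrite -EFinM lee_fin indicE.
have [/[dup] Sy' /Sy[kuy auy enD]|nS] := pselect (S y); last first.
  by rewrite memNset// mulr0 !mulr_ge0 ?invr_ge0 ?powR_ge0.
rewrite mem_set// mulr1 indicE mem_set ?mul1r; last by apply/negP; rewrite -leNgt.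
have xy : x - y != 0.
  rewrite subr_eq0; apply/eqP => xy; move: auy; rewrite xy subrr; lra.
apply: ler_pM; rewrite ?invr_ge0 ?powR_ge0//.
  have uxy : 0 <= u y - u x by exact: le_trans (ltW a0) auy.
  by rewrite ge0_ler_powR ?nnegrE ?(ltW a0)//; lra.
rewrite lef_pV2 ?posrE ?powR_gt0 ?enorm_gt0//.
by rewrite ge0_ler_powR ?nnegrE ?enorm_ge0 ?(ltW q0)// ltW.
Qed.

Lemma fine_sublevel_ge0 k r : 0 <= m k r.
Proof. by rewrite fine_ge0. Qed.

Lemma fine_sublevel_le_ball k r : 0 < r -> m k r <= (2 * r) ^+ N.
Proof.
move=> r_gt0; rewrite -lee_fin fineK ?sublevel_fin_num// -(rV_lebesgue_ball x0)//.
apply: le_measure; rewrite ?inE//; last by move=> x [].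
  exact: measurable_sublevel.
exact: measurable_rV_ball.
Qed.

(** Mass at height [del] forces the small sublevel sets to be rare: this
    starts the iteration. *)
Lemma sublevel_small (del : R) (S : set 'rV[R]_N) (eps : R) :
  0 < del -> measurable S -> bounded_set S ->
  (0 < mu S)%E -> (forall y, S y -> del <= u y) -> 0 < eps ->
  exists2 k, 0 < k & m k (r0 / 2) <= eps.
Proof.
move=> del0 mS bS S0 Sdel eps0; have p1 := p_gt1; have r00 := r0_gt0.
have [B B0 SB] := ex_strict_bound_gt0 bS.
(* An upper bound of the Euclidean distances between S and the ball. *)
pose D : R := N%:R * (`|x0| + r0 + B).
have D0 : 0 < D by rewrite mulr_gt0 ?ltr0n// addr_gt0// ltr_wpDl.
have Sfin : mu S \is a fin_num.
  rewrite ge0_fin_numE//; apply: (@le_lt_trans _ _ (mu (ball 0 B))).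
    apply: le_measure; rewrite ?inE//; first exact: measurable_rV_ball.
    by move=> y /SB; rewrite rV_ballE /= sub0r normrN.
  by rewrite rV_lebesgue_ball// ltry.
have kap0 : 0 < fine (mu S) by rewrite fine_gt0// S0 ltey_eq Sfin.
pose G := (del / 2) `^ (p - 1) / D `^ q * fine (mu S).
have G0 : 0 < G by rewrite !mulr_gt0 ?invr_gt0 ?powR_gt0// divr_gt0.
pose r2 := 3 * r0 / 4.
have r2_gt0 : 0 < r2 by rewrite /r2; lra.
pose C1 := 2 * C * (r2 - r0 / 2)^-1 `^ p * (2 * r2) ^+ N / G.
have C10 : 0 < C1.
  have d0 : 0 < r2 - r0 / 2 by rewrite /r2; lra.
  apply: divr_gt0 => //; apply: mulr_gt0; last by rewrite exprn_gt0// mulr_gt0.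
  by apply: mulr_gt0; [rewrite mulr_gt0|rewrite powR_gt0// invr_gt0].
(* The exponent makes C1 * k ^ (p - 1) at most eps. *)
pose k := Num.min (del / 2) ((eps / C1) `^ (p - 1)^-1).
have k0 : 0 < k.
  by rewrite lt_min; apply/andP; split; [exact: divr_gt0|exact: powR_gt0 (divr_gt0 eps0 C10)].
have kdel : k <= del / 2 by rewrite ge_min lexx.
have kpow : k `^ (p - 1) <= eps / C1.
  apply: (@le_trans _ _ (((eps / C1) `^ (p - 1)^-1) `^ (p - 1))).
    rewrite ge0_ler_powR ?nnegrE ?powR_ge0 ?(ltW k0)//; first by lra.
    by rewrite ge_min lexx orbT.
  have p10 : p - 1 != 0 by rewrite subr_eq0 gt_eqF.
  by rewrite -powRrM (mulVf p10) powRr1// ltW// divr_gt0.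
(* The growth estimate is applied between the levels k / 2 and k. *)
exists (k / 2); first by rewrite divr_gt0.
have := @level_set_growth_mass k (k / 2) (r0 / 2) r2 (del / 2) D (fine (mu S)).
rewrite -/G; have -> : k - k / 2 = k / 2 by field.
move=> H; have {H} : k / 2 * G * m (k / 2) (r0 / 2) <=
    C * k `^ p * (r2 - r0 / 2)^-1 `^ p * m k r2.
  apply: H; rewrite ?divr_gt0//; try (rewrite /r2; lra).
  move=> x [/= ux xr]; exists S; split => //; first by rewrite fineK.
  move=> y Sy; have uy := Sdel _ Sy; split; [lra|lra|].
  apply: (le_trans (enorm_le_norm _)); rewrite ler_wpM2l// (le_trans (ler_normB _ _))//.
  apply: lerD; last exact/ltW/SB.
  rewrite -[x](subKr x0) (le_trans (ler_normB _ _))// lerD2l.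
  by move: xr; rewrite rV_ballE /=; lra.
have : m k r2 <= (2 * r2) ^+ N by exact: fine_sublevel_le_ball.
move=> mk /le_trans /(_ (ler_wpM2l _ mk)).
have L0 : 0 <= C * k `^ p * (r2 - r0 / 2)^-1 `^ p.
  by rewrite !mulr_ge0 ?powR_ge0// ltW.
move=> /(_ L0) H.
have {}H : G * m (k / 2) (r0 / 2) <= G * (C1 * k `^ (p - 1)).
  rewrite -(ler_pM2l (_ : 0 < k / 2)) ?divr_gt0// [leLHS]mulrA (le_trans H)//.
  rewrite -(powR_subr1_mulr p_gt1 (ltW k0)) le_eqVlt; apply/orP; left; apply/eqP.
  by rewrite /C1; field; rewrite gt_eqF.
rewrite ler_pM2l// in H; apply: (le_trans H).
by rewrite mulrC -ler_pdivlMr.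
Qed.

(** Used both for the levels, which decrease to [k], and for the radii. *)
Definition dg_level (k : R) (j : nat) : R := k * (1 + 2 ^- j).

Lemma dg_levelS k j : dg_level k j - dg_level k j.+1 = k * 2 ^- j.+1.
Proof. by rewrite /dg_level exprS invfM; field. Qed.

(** One step: around a point of the next sublevel set, half of a ball of radius
    [rho] lies above the present level, and its kernel mass beats the error terms
    because [rho] is small. *)
Lemma dg_step k r rho lam j : 0 < k -> 0 < r -> dg_level r 0 < r0 -> 0 < rho -> 0 < lam ->
  rho <= r * 2 ^- j.+1 ->
  C * 2 `^ p * r^-1 `^ p * N%:R `^ q * (2 ^+ j.+1 * 2 ^+ j.+1) `^ p * rho `^ (s * p)
    <= lam ^+ N ->
  2 * m (dg_level k j) (dg_level r j) <= (2 * rho) ^+ N ->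
  2 * m (dg_level k j.+1) (dg_level r j.+1) <= (2 * (lam * rho)) ^+ N.
Proof.
move=> k0 r_gt0 rr0 rho0 lam0 rhor small Pj.
have p1 := p_gt1; have p0 : 0 < p by lra.
have h0 (i : nat) : 0 < 2 ^- i :> R by rewrite invr_gt0 exprn_gt0.
have h1 (i : nat) : 2 ^- i <= 1 :> R by rewrite invf_le1 ?exprn_gt0// exprn_ege1// ler1n.
have lev0 (t : R) i : 0 < t -> 0 < dg_level t i.
  by move=> t0; rewrite mulr_gt0// addr_gt0.
set h := 2 ^- j.+1 in rhor *.
pose D := N%:R * rho; pose kap := (2 * rho) ^+ N / 2.
have N0 : 0 < N%:R :> R by rewrite ltr0n.
have D0 : 0 < D by rewrite mulr_gt0.
have rhoN0 : 0 < (2 * rho) ^+ N by rewrite exprn_gt0// mulr_gt0.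
have kap0 : 0 < kap by rewrite divr_gt0.
have mj : m (dg_level k j) (dg_level r j) <= kap.
  by rewrite /kap ler_pdivlMr// mulrC.
have hh0 : 0 < h by exact: h0.
have kh0 : 0 < k * h by rewrite mulr_gt0.
have levk := dg_levelS k j; have levr := dg_levelS r j.
rewrite -/h in levk levr.
have rh0 : 0 < r * h by rewrite mulr_gt0.
have step : k * h * ((k * h) `^ (p - 1) / D `^ q * kap) *
    m (dg_level k j.+1) (dg_level r j.+1) <=
    C * dg_level k j `^ p * (r * h)^-1 `^ p * m (dg_level k j) (dg_level r j).
  rewrite -levr -{1}levk; apply: level_set_growth_mass => //.
  - exact: lev0.
  - by rewrite -subr_gt0 levk.
  - exact: lev0.
  - by rewrite -subr_gt0 levr.
  - apply: le_lt_trans rr0; rewrite /dg_level ler_wpM2l ?(ltW r_gt0)// lerD2l.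
    by rewrite expr0 invr1.
  - exact: ltW.
  move=> x [/= ux xr].
  (* The part of the ball above the level; it has at least half of its measure. *)
  exists (ball x rho `\` sublevel (dg_level k j) (dg_level r j)).
  have mS := measurable_sublevel x0 meas_u (dg_level k j) (dg_level r j).
  have mB := measurable_rV_ball x rho.
  have ballsub : ball x rho `<=` ball x0 (dg_level r j).
    move=> y; move: xr; rewrite !rV_ballE /= => xr yr.
    have := ler_normD (x0 - x) (x - y); rewrite subrKA; lra.
  split; first exact: measurableD.
    have finS : mu (sublevel (dg_level k j) (dg_level r j)) \is a fin_num.
      by apply: sublevel_fin_num => //; exact: lev0.
    have : (mu (ball x rho) <= mu (ball x rho `\` sublevel (dg_level k j) (dg_level r j))
        + mu (sublevel (dg_level k j) (dg_level r j)))%E.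
      apply: (@le_trans _ _ (mu ((ball x rho `\` sublevel (dg_level k j) (dg_level r j))
          `|` sublevel (dg_level k j) (dg_level r j)))).
        apply: le_measure; rewrite ?inE//.
          by apply: measurableU => //; exact: measurableD.
        by move=> y By; have [?|?] := pselect (sublevel (dg_level k j) (dg_level r j) y);
          [right|left].
      by apply: measureU2 => //; exact: measurableD.
    rewrite -leeBlDr// rV_lebesgue_ball//; apply: le_trans.
    rewrite -(fineK finS) -EFinB lee_fin.
    by move: mj; rewrite /kap; lra.
  move=> y [By nS].
  have uy : dg_level k j <= u y.
    by rewrite leNgt; apply/negP => uy; apply: nS; split => //; exact: ballsub.
  split => //; first by rewrite -levk; lra.
  apply: (le_trans (enorm_le_norm _)); rewrite ler_wpM2l//.
  by move: By; rewrite rV_ballE => /ltW.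
have Dq0 : 0 < D `^ q by rewrite powR_gt0.
have levk2 : dg_level k j <= 2 * k.
  by rewrite /dg_level mulrC ler_wpM2r ?(ltW k0)// (_ : 2 = 1 + 1) ?lerD2l.
have kp0 : 0 < k `^ p by rewrite powR_gt0.
have hp0 : 0 < h `^ p by rewrite powR_gt0.
have {}step : k `^ p * kap * (h `^ p * m (dg_level k j.+1) (dg_level r j.+1)) <=
    k `^ p * kap * (C * 2 `^ p * r^-1 `^ p * h^-1 `^ p * D `^ q).
  move: step; rewrite (_ : k * h * _ * _ = (k * h) `^ p / D `^ q * kap *
      m (dg_level k j.+1) (dg_level r j.+1)); last first.
    by rewrite -(powR_subr1_mulr p_gt1 (ltW kh0)); ring.
  rewrite -(ler_pM2r Dq0) powRM ?(ltW k0) ?(ltW hh0)//.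
  rewrite [leLHS](_ : _ = k `^ p * kap *
    (h `^ p * m (dg_level k j.+1) (dg_level r j.+1))); last first.
    by field; rewrite gt_eqF.
  move/le_trans; apply.
  have -> : (r * h)^-1 `^ p = r^-1 `^ p * h^-1 `^ p.
    by rewrite invfM powRM ?invr_ge0 ?(ltW r_gt0) ?(ltW hh0).
  apply: (@le_trans _ _ (C * (2 * k) `^ p * (r^-1 `^ p * h^-1 `^ p) * kap * D `^ q)).
    rewrite ler_wpM2r ?(ltW Dq0)//; apply: ler_pM => //.
    + by rewrite !mulr_ge0 ?powR_ge0// ltW.
    + exact: fine_sublevel_ge0.
    rewrite ler_wpM2r ?mulr_ge0 ?powR_ge0// ler_wpM2l ?(ltW C_gt0)//.
    by rewrite ge0_ler_powR ?nnegrE ?(ltW p0)// ?ltW ?lev0// mulr_gt0.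
  rewrite powRM ?(ltW k0)// le_eqVlt; apply/orP; left; apply/eqP; ring.
have kk0 : 0 < k `^ p * kap by rewrite mulr_gt0.
rewrite ler_pM2l// in step.
have {}step : m (dg_level k j.+1) (dg_level r j.+1) <=
    C * 2 `^ p * r^-1 `^ p * (h^-1 * h^-1) `^ p * D `^ q.
  rewrite -(ler_pM2l hp0); apply: (le_trans step).
  rewrite [(h^-1 * h^-1) `^ p]powRM ?invr_ge0 ?(ltW hh0)//.
  have hi : h `^ p * h^-1 `^ p = 1.
    by rewrite -powRM ?invr_ge0 ?(ltW hh0)// divff ?powR1// gt_eqF.
  rewrite [leRHS](_ : _ = h `^ p * h^-1 `^ p *
    (C * 2 `^ p * r^-1 `^ p * h^-1 `^ p * D `^ q)); last by ring.
  by rewrite hi mul1r.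
have rhoq : D `^ q = N%:R `^ q * rho ^+ N * rho `^ (s * p).
  rewrite /D powRM ?(ltW rho0)// -mulrA; congr (_ * _).
  by rewrite powRD ?(gt_eqF rho0) ?implybT// powR_mulrn ?ltW.
have h2 : 2 <= 2 ^+ N :> R.
  by rewrite -[leLHS]expr1 ler_weXn2l// ler1n.
apply: (@le_trans _ _ (2 * (lam ^+ N * rho ^+ N))).
  rewrite ler_wpM2l//; apply: (le_trans step); rewrite rhoq /h invrK.
  rewrite [leLHS](_ : _ = (C * 2 `^ p * r^-1 `^ p * N%:R `^ q *
    (2 ^+ j.+1 * 2 ^+ j.+1) `^ p * rho `^ (s * p)) * rho ^+ N); last by ring.
  by rewrite ler_wpM2r// exprn_ge0// ltW.
by rewrite !exprMn ler_wpM2r// mulr_ge0 ?exprn_ge0// ltW.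
Qed.

(** The radii are [rho0 * lam ^ j] with [lam `^ s = 1 / 4], so that the powers of 4
    produced by the shrinking steps are exactly compensated. *)
Lemma sublevel_not_nbhs (del : R) (S : set 'rV[R]_N) :
  0 < del -> measurable S -> bounded_set S -> (0 < mu S)%E ->
  (forall y, S y -> del <= u y) ->
  exists2 k, 0 < k & forall tau, 0 < tau -> ~ (ball x0 tau `<=` [set x | u x < k]).
Proof.
move=> del0 mS bS S0 Sdel; have p1 := p_gt1; have p0 : 0 < p by lra.
have s0 := s_gt0; have s1 := s_lt1; have r00 := r0_gt0.
have sp0 : 0 < s * p by rewrite mulr_gt0.
(* The iteration starts from the ball of radius 2 * r = r0 / 2. *)
pose r := r0 / 4; have r_gt0 : 0 < r by rewrite /r; lra.
have r2E : dg_level r 0 = r0 / 2 by rewrite /dg_level expr0 invr1 /r; field.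
pose lam : R := 4 `^ (- s^-1).
have lam0 : 0 < lam by rewrite powR_gt0.
have lams : lam `^ s = 4^-1 by rewrite -powRrM mulNr mulVf ?gt_eqF// powR_inv1.
have lam2 : lam <= 2^-1.
  apply: (@le_trans _ _ (4 `^ (- 1))); last by rewrite powR_inv1//; lra.
  by rewrite ler_powR ?ler1n// lerN2 invf_ge1// ltW.
pose C0 := C * 2 `^ p * r^-1 `^ p * N%:R `^ q * 4 `^ p.
have C00 : 0 < C0.
  by rewrite /C0 !mulr_gt0 ?powR_gt0 ?invr_gt0 ?ltr0n.
have lamC0 : 0 < lam ^+ N / C0 by rewrite divr_gt0// exprn_gt0.
pose rho0 : R := Num.min (r / 2) ((lam ^+ N / C0) `^ (s * p)^-1).
have rho00 : 0 < rho0.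
  by rewrite lt_min; apply/andP; split; [exact: divr_gt0|exact: powR_gt0].
have rho0r : rho0 <= r / 2 by rewrite ge_min lexx.
have rho0C : C0 * rho0 `^ (s * p) <= lam ^+ N.
  rewrite mulrC -ler_pdivlMr//.
  apply: (@le_trans _ _ (((lam ^+ N / C0) `^ (s * p)^-1) `^ (s * p))).
    rewrite ge0_ler_powR ?nnegrE ?powR_ge0 ?(ltW rho00) ?(ltW sp0)//.
    by rewrite ge_min lexx orbT.
  by rewrite -powRrM mulVf ?gt_eqF// powRr1// ltW.
have eps0 : 0 < (2 * rho0) ^+ N / 2 by rewrite divr_gt0// exprn_gt0// mulr_gt0.
have [k' k'0 mk'] := sublevel_small del0 mS bS S0 Sdel eps0.
pose k := k' / 2; have k0 : 0 < k by rewrite divr_gt0.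
have k2E : dg_level k 0 = k' by rewrite /dg_level expr0 invr1 /k; field.
pose rho j := rho0 * lam ^+ j.
have rhoj0 j : 0 < rho j by rewrite mulr_gt0// exprn_gt0.
have lam2j j : lam ^+ j <= 2 ^- j.
  by rewrite -exprVn lerXn2r ?nnegrE ?invr_ge0// ltW.
have P j : 2 * m (dg_level k j) (dg_level r j) <= (2 * rho j) ^+ N.
  elim: j => [|j IH].
    rewrite k2E r2E /rho expr0 mulr1; have := mk'.
    by rewrite ler_pdivlMr// [X in X <= _ -> _]mulrC.
  rewrite (_ : rho j.+1 = lam * rho j); last by rewrite /rho exprS; ring.
  apply: dg_step => //.
  - by rewrite r2E; lra.
  - rewrite /rho exprS invfM mulrA ler_pM ?exprn_ge0 ?(ltW rho00) ?(ltW lam0)//.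
  apply: le_trans rho0C; rewrite le_eqVlt; apply/orP; left; apply/eqP.
  have e1 : (lam ^+ j) `^ (s * p) = (4 ^- j) `^ p.
    rewrite powRrM; congr (_ `^ _).
    by rewrite -powR_mulrn ?(ltW lam0)// powRAC lams powR_mulrn ?invr_ge0// exprVn.
  have e2 : (2 ^+ j.+1 * 2 ^+ j.+1) = 4 * 4 ^+ j :> R.
    by rewrite -exprMn exprS; congr (_ * _); [ring|congr (_ ^+ _); ring].
  have -> : rho j `^ (s * p) = rho0 `^ (s * p) * (lam ^+ j) `^ (s * p).
    by rewrite powRM ?exprn_ge0 ?(ltW rho00) ?(ltW lam0).
  rewrite e1 e2.
  rewrite [(4 * _) `^ p]powRM ?exprn_ge0//.
  have e3 : (4 ^+ j) `^ p * (4 ^- j) `^ p = 1 :> R.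
    by rewrite -powRM ?invr_ge0 ?exprn_ge0// divff ?powR1// expf_neq0.
  rewrite [LHS](_ : _ = C0 * rho0 `^ (s * p) * ((4 ^+ j) `^ p * (4 ^- j) `^ p)); last first.
    by rewrite /C0; ring.
  by rewrite e3 mulr1.
exists k => // tau tau0 sub.
pose t := Num.min tau r; have t0 : 0 < t by rewrite lt_min tau0.
have [j jt] : exists j, rho j < t.
  exists (Num.bound (rho0 / t)); set j := Num.bound _.
  apply: (@le_lt_trans _ _ (rho0 * 2 ^- j)); first by rewrite ler_wpM2l// ltW.
  rewrite ltr_pdivrMr ?exprn_gt0// mulrC -ltr_pdivrMr//.
  apply: (lt_trans (archi_boundP _)); first by rewrite divr_ge0// ltW.
  by rewrite -natrX ltr_nat ltn_expl.
have h0 (i : nat) : 0 < 2 ^- i :> R by rewrite invr_gt0 exprn_gt0.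
have : (2 * t) ^+ N <= m (dg_level k j) (dg_level r j).
  have levr0 : 0 < dg_level r j by rewrite mulr_gt0// addr_gt0.
  rewrite -lee_fin fineK ?sublevel_fin_num// -(rV_lebesgue_ball x0)//.
  apply: le_measure; rewrite ?inE.
  - exact: measurable_rV_ball.
  - exact: measurable_sublevel.
  move=> y yt; split.
    have /sub /= uk : ball x0 tau y.
      by move: yt; rewrite !rV_ballE /= lt_min => /andP[].
    by apply: (lt_le_trans uk); rewrite /dg_level ler_peMr ?(ltW k0)// lerDl ltW.
  move: yt; rewrite !rV_ballE /= lt_min => /andP[_ yr].
  by apply: (lt_le_trans yr); rewrite /dg_level ler_peMr ?(ltW r_gt0)// lerDl ltW.
have : (2 * rho j) ^+ N < (2 * t) ^+ N.
  have lt2 : 2 * rho j < 2 * t by rewrite ltr_pM2l.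
  have ge2 : 0 <= 2 * rho j by rewrite mulr_ge0// ltW.
  by rewrite ltr_pXn2r// nnegrE (le_trans ge2)// ltW.
have := P j; have : 0 < (2 * t) ^+ N by rewrite exprn_gt0// mulr_gt0.
lra.
Qed.

End de_giorgi.

(** * Compactness, measurability and mass *)

Section auxiliary.
Context {R : realType} {N : nat}.
Local Notation mu := (rV_lebesgue R N).
Implicit Types (u c : 'rV[R]_N -> R) (U K Omega : set 'rV[R]_N).

Lemma bounded_measure_lty Omega : measurable Omega -> bounded_set Omega ->
  (mu Omega < +oo)%E.
Proof.
move=> mO bO; have [B B0 OB] := ex_strict_bound_gt0 bO.
apply: (@le_lt_trans _ _ (mu (ball 0 B))); last by rewrite rV_lebesgue_ball// ltry.
apply: le_measure; rewrite ?inE//; first exact: measurable_rV_ball.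
by move=> y /OB; rewrite rV_ballE /= sub0r normrN.
Qed.

(** By compactness a single radius serves for all points of [K]. *)
Lemma compact_open_separation K U : compact K -> open U -> K `<=` U ->
  exists2 del : R, 0 < del <= 1 & forall x y, K x -> ~ U y -> del <= `|x - y|.
Proof.
move=> /compact_near_coveringP cK oU KU.
have := cK R (0 : R)^'+ (fun e x => ball x e `<=` U) _.
have near_U x : K x -> \forall x' \near x & e \near (0 : R)^'+, ball x' e `<=` U.
  move=> /KU Ux; have /nbhs_ballP[e /= e0 xeU] : nbhs x U by exact: open_nbhs_nbhs.
  exists (ball x (e / 2), [set d | d < e / 2]).
    split; first by apply: nbhsx_ballx; rewrite divr_gt0.
    by apply: nbhs_right_lt; rewrite divr_gt0.
  move=> [x' d] /= [xx' de] y; rewrite rV_ballE /= => x'y; apply: xeU.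
  move: xx'; rewrite !rV_ballE /= => xx'.
  by rewrite -(subrKA x') (le_lt_trans (ler_normD _ _))// [e]splitr ltrD// (lt_trans x'y).
move=> /(_ _ near_U) near_K.
have [e [e01 eK]] : exists e : R, 0 < e <= 1 /\ K `<=` (fun x => ball x e `<=` U).
  have : \forall e \near (0 : R)^'+, 0 < e <= 1 /\ K `<=` (fun x => ball x e `<=` U).
    near=> e; split; last by near: e; exact: near_K.
    by apply/andP; split; near: e; [exact: nbhs_right_gt|exact: nbhs_right_le].
  by move=> /filter_ex.
exists e => // x y Kx Uy; rewrite leNgt; apply/negP => xy.
by apply: Uy; apply: (eK x Kx); rewrite rV_ballE.
Unshelve. all: by end_near. Qed.

Lemma open_continuous_measurable c Omega : open Omega ->
  {in Omega, continuous c} -> measurable_fun Omega c.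
Proof.
move=> oO cc; apply: (measurability _ (RGenOpens.measurableE R)).
move=> _ [_ [a [b ->]] <-]; apply: rV_open_measurable.
rewrite openE => x [Ox cx].
apply: filterI; first exact: open_nbhs_nbhs.
have := cc x (mem_set Ox); apply.
by apply: open_nbhs_nbhs; split => //; exact: interval_open.
Qed.

Lemma Rintegral_ge_of_bound (D E : set 'rV[R]_N) (g : 'rV[R]_N -> R) (B : R) :
  measurable D -> measurable E -> (mu E < +oo)%E -> measurable_fun D g -> 0 <= B ->
  (forall x, D x -> `|g x| <= B * \1_E x) ->
  - (B * fine (mu E)) <= \int[mu]_(x in D) g x.
Proof.
move=> mD mE Eoo mg B0 gB.
have finE : mu E \is a fin_num by rewrite ge0_fin_numE.
have : (`| \int[mu]_(x in D) (g x)%:E | <= (B * fine (mu E))%:E)%E.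
  apply: (le_trans (le_abse_integral _ _ _)) => //; first exact/measurable_EFinP.
  apply: (@le_trans _ _ (\int[mu]_(x in D) (B%:E * (\1_E x)%:E))%E).
    apply: ge0_le_integral => //.
    - by apply: (measurableT_comp (@abse_measurable _ _)); exact/measurable_EFinP.
    - by apply: measurable_funeM; apply/measurable_EFinP;
        apply: (measurable_funS measurableT) => //; exact: measurable_indic.
  rewrite ge0_integralZl_EFin//; last first.
    by apply/measurable_EFinP; apply: (measurable_funS measurableT) => //;
      exact: measurable_indic.
  rewrite integral_indic// EFinM fineK// lee_wpmul2l ?lee_fin//.
  by apply: le_measure; rewrite ?inE//; exact: measurableI.
rewrite /Rintegral; case: (\int[mu]_(x in D) (g x)%:E)%E => [r| |] //=.
by rewrite lee_fin ler_norml => /andP[].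
Qed.

Lemma Wtilde_measurable (s p : R) Omega phi : Wtilde s p Omega phi ->
  measurable_fun setT phi.
Proof.
move=> [_ [+ _] phiO]; rewrite phiO /memLp patch_setT => /sub_Lfun_mfun.
by rewrite inE.
Qed.

Lemma continuous_bounded_on c K : {within K, continuous c} -> compact K ->
  exists2 M : R, 0 <= M & forall x, K x -> `|c x| <= M.
Proof.
move=> cc cK; have /compact_bounded bK := @continuous_compact _ _ c K cc cK.
have [M M0 KM] := ex_strict_bound_gt0 bK; exists M; first exact: ltW.
by move=> x Kx; apply/ltW/KM; exists x.
Qed.

(** The set where [u > 0] is the union over [n] of the sets where [u >= 1 / (n + 1)] in
    the ball of radius [n], so that one of them is not negligible. *)
Lemma mass_of_not_ae_eq0 u : measurable_fun setT u -> (forall x, 0 <= u x) ->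
  ~ {ae mu, forall x, u x = 0} -> exists del : R, exists S : set 'rV[R]_N,
    [/\ 0 < del, measurable S, bounded_set S, (0 < mu S)%E &
      forall y, S y -> del <= u y].
Proof.
move=> meas_u u0 nz; apply: contrapT => H; apply: nz.
pose S (n : nat) := [set x | n.+1%:R^-1 <= u x] `&` ball 0 n%:R.
have mS n : measurable (S n).
  apply: measurableI; last exact: measurable_rV_ball.
  rewrite -[X in measurable X]setTI.
  rewrite (_ : [set x | _] = u @^-1` [set` `[n.+1%:R^-1, +oo[]); last first.
    by apply/seteqP; split => x /=; rewrite in_itv /= andbT.
  exact: meas_u.
have S0 n : mu.-negligible (S n).
  apply/negligibleP => //; apply/eqP; rewrite eq_le measure_ge0 andbT leNgt.
  apply/negP => Sn; apply: H; exists n.+1%:R^-1, (S n); split => //.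
  - apply: (@bounded_norm_le _ _ n%:R) => x [_].
    by rewrite rV_ballE /= sub0r normrN => /ltW.
  - by move=> y [].
apply: negligibleS (negligible_bigcup S0) => x /= ux0.
have ux : 0 < u x by rewrite lt_neqAle u0 andbT eq_sym; apply/eqP.
pose n := maxn (Num.bound (u x)^-1) (Num.bound `|x|).
exists n => //; split => /=.
  rewrite -[leRHS]invrK lef_pV2 ?posrE ?invr_gt0//.
  apply: (le_trans (ltW (archi_boundP _))); first by rewrite invr_ge0 ltW.
  by rewrite ler_nat ltnW// ltnS leq_maxl.
rewrite rV_ballE /= sub0r normrN; apply: (lt_le_trans (archi_boundP _)) => //.
by rewrite ler_nat leq_maxr.
Qed.

End auxiliary.

(** * The minimum principles *)

Section minimum_principle.
Context {R : realType} {N : nat} (s p : R).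
Hypotheses (N_gt0 : (0 < N)%N) (s_gt0 : 0 < s) (s_lt1 : s < 1) (p_gt1 : 1 < p).
Local Notation mu := (rV_lebesgue R N).
Local Notation mu2 := (mu \x mu)%E.
Local Notation q := (N%:R + s * p).
Variables (Omega : set 'rV[R]_N) (Omega_open : open Omega).
Variables (c u : 'rV[R]_N -> R).
Hypothesis c_le0 : forall x, Omega x -> c x <= 0.
Hypothesis u_cont : {within closure Omega, continuous u}.
Hypothesis u_Wcal : Wcal s p Omega u.
Local Notation f := (fun x => c x * spow p (u x)).

Let meas_u : measurable_fun setT u.
Proof. by case: u_Wcal => Lu _ _; exact: memLp_loc_measurable Lu. Qed.

Let mOmega : measurable Omega.
Proof. exact: rV_open_measurable. Qed.

(** Testing the inequality with the negative part of [u]: the zero order term has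
    the good sign because [c <= 0], so that the energy of the negative part
    vanishes; interaction with a ball far away shows that it is zero. *)
Lemma weak_minimum_principle : bounded_set Omega ->
  weak_supersol_bounded s p Omega (pairing Omega f) u ->
  {ae mu, forall x, (~` Omega) x -> 0 <= u x} -> {ae mu, forall x, 0 <= u x}.
Proof.
move=> bO [_ _ super] u_ext.
have p1 := p_gt1; have p0 : 0 < p by lra.
have q0 : 0 < q by rewrite ltr_wpDl// mulr_gt0.
have [U [oU cptO OU [_ uU]]] : exists U : set 'rV[R]_N,
    [/\ open U, compact (closure Omega), closure Omega `<=` U & Wsp s p U u].
  by case: u_Wcal => _ /(_ Omega bO) + _; apply.
have mU : measurable U by exact: rV_open_measurable.
have [del del01 sep] := compact_open_separation cptO oU OU.
have [M M0 uM] := continuous_bounded_on u_cont cptO.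
(* Equal to u in Omega and to its positive part outside. *)
pose w x := Num.max (u x) ((u \_ Omega) x).
have mw : measurable_fun setT w.
  apply: measurable_maxr => //; apply: (measurable_restrictT u mOmega).1.
  by apply: (measurable_funS measurableT).
have w_in x : Omega x -> w x = u x.
  by move=> Ox; rewrite /w patchE mem_set// maxxx.
have w_out x : ~ Omega x -> w x = Num.max (u x) 0.
  by move=> Ox; rewrite /w patchE memNset.
have uw : {ae mu, forall x, u x = w x}.
  apply: filterS u_ext => x ux; have [Ox|Ox] := pselect (Omega x).
    by rewrite w_in.
  by rewrite w_out// max_l// ux.
pose phi x := Num.max 0 (- w x).
have mphi : measurable_fun setT phi.
  by apply: measurable_maxr => //; exact: measurable_funN.
have phi0 x : 0 <= phi x by rewrite le_max lexx.
have phi_out x : ~ Omega x -> phi x = 0.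
  by move=> Ox; rewrite /phi w_out// max_l// oppr_le0 le_max lexx orbT.
have Wphi : Wtilde s p Omega phi.
  apply: (Wtilde_of_increments s_gt0 s_lt1 p_gt1 mOmega mU mOmega mw mphi
    (fun _ => id) (bounded_measure_lty mOmega bO) M0 (lexx 0) del01 _ phi_out).
  - move=> x; have [Ox|Ox] := pselect (Omega x); last by rewrite phi_out// normr0.
    rewrite ger0_norm// /phi ge_max M0/= w_in//.
    have := uM x (subset_closure Ox); rewrite ler_norml => /andP[+ _].
    by rewrite lerNl.
  - by move=> x y Ox Uy; apply: sep => //; exact: subset_closure.
  - move=> x y _ _; rewrite mul0r addr0 /phi.
    have [h1|h1] := leP 0 (- w x); have [h2|h2] := leP 0 (- w y).
    + by rewrite opprK addrC distrC.
    + rewrite subr0 ger0_norm// ler_normr; apply/orP; right; lra.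
    + by rewrite sub0r normrN ger0_norm// ler_normr; apply/orP; left; lra.
    + by rewrite subrr normr0.
  - by rewrite -(@gagliardo_ae _ _ s p U u w).
have pair0 : 0 <= pairing Omega f phi.
  apply: Rintegral_ge0 => x Ox /=; rewrite /phi w_in//.
  have [ux|ux] := leP 0 (- u x); last by rewrite mulr0.
  have ux0 : u x <= 0 by lra.
  rewrite mulr_ge0// mulr_le0 ?c_le0// -[u x]opprK spowN oppr_le0.
  by rewrite (spow_ge0E p_gt1)// powR_ge0.
have form0 : ((pairing Omega f phi)%:E <= fracplap_form s p w phi)%E.
  rewrite -(@fracplap_form_ae _ _ s p u w phi)//; apply: super => //.
  exact: aeW.
have [B B0 OB] := ex_strict_bound_gt0 bO.
(* E is a ball outside Omega, which lies within distance B of the origin. *)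
pose e : 'rV[R]_N := const_mx (B + 1); pose E := ball e (1 : R).
have mE : measurable E by exact: measurable_rV_ball.
have EO y : E y -> ~ Omega y.
  rewrite /E rV_ballE /= => /(rV_norm_ltP _ ltr01) /(_ (Ordinal N_gt0)) ey /OB /= yB.
  have := le_lt_trans (rV_coord_le_norm y (Ordinal N_gt0)) yB.
  move: ey; rewrite rV_subE mxE ltr_norml ltr_norml => /andP[_ h1] /andP[_ h2].
  by move: h1 h2; lra.
pose ker (z : 'rV[R]_N * 'rV[R]_N) : R := \1_E z.2 / enorm (z.1 - z.2) `^ q.
have mker : measurable_fun setT ker.
  apply: measurable_funM; last first.
    exact: (measurable_inv_enorm_powR q measurable_fst measurable_snd).
  by apply: measurableT_comp => //; exact: measurable_indic.
pose g2 (z : 'rV[R]_N * 'rV[R]_N) : R := phi z.1 `^ p * ker z.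
have mphip : measurable_fun setT (fun x => phi x `^ p).
  exact: (measurableT_comp (measurable_powR _)).
have mg2 : measurable_fun setT g2.
  by apply: measurable_funM => //; exact: (measurableT_comp mphip).
have ker0 z : 0 <= ker z by rewrite divr_ge0 ?powR_ge0.
have g20 z : 0 <= g2 z by rewrite mulr_ge0 ?powR_ge0.
have mf : measurable_fun setT (fun z : 'rV[R]_N * 'rV[R]_N =>
    spow p (w z.1 - w z.2) * (phi z.1 - phi z.2) / enorm (z.1 - z.2) `^ q).
  exact: measurable_fracplap_integrand.
have sign a b : spow p (a - b) * (Num.max 0 (- a) - Num.max 0 (- b)) <= 0.
  wlog ab : a b / a <= b.
    move=> H; have [ab|ba] := leP a b; first exact: H.
    by have := H b a (ltW ba); rewrite -mulrNN -spowN !opprB.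
  rewrite -[a - b]opprB spowN mulNr oppr_le0 mulr_ge0//.
    by rewrite (spow_ge0E p_gt1) ?powR_ge0// subr_ge0.
  by rewrite subr_ge0 ge_max !le_max lexx lerN2 ab orbT.
have fg z : spow p (w z.1 - w z.2) * (phi z.1 - phi z.2) / enorm (z.1 - z.2) `^ q
    + g2 z <= cst 0 z.
  case: z => x y; rewrite /g2 /ker /= mulrA -mulrDl.
  rewrite mulr_le0_ge0 ?invr_ge0 ?powR_ge0// indicE.
  have [Ey|nEy] := pselect (E y); last first.
    by rewrite memNset// mulr0 addr0; exact: sign.
  rewrite mem_set// mulr1 (phi_out y (EO y Ey)) subr0.
  have wy : 0 <= w y by rewrite w_out ?le_max ?lexx ?orbT//; exact: EO.
  have [wx|wx] := leP 0 (w x).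
    have -> : phi x = 0 by rewrite /phi max_l// oppr_le0.
    by rewrite mulr0 powR0 ?addr0// gt_eqF.
  have -> : phi x = - w x by rewrite /phi max_r// oppr_ge0 ltW.
  have nw : 0 <= - w x by lra.
  rewrite -[w x - w y]opprB spowN (spow_ge0E p_gt1); last by lra.
  rewrite -(powR_subr1_mulr p_gt1 nw) mulNr addrC subr_le0 ler_wpM2r//.
  by rewrite ge0_ler_powR ?nnegrE//; lra.
have int0 : (\int[mu2]_z (cst (0 : R) z)%:E <= (0 : R)%:E)%E.
  by rewrite integral0_eq.
have upper := integral_absorb mf (measurable_cst (0 : R)) mg2 (fun=> lexx (0 : R))
  g20 fg form0 int0.
have {upper} : (\int[mu2]_z (g2 z)%:E <= 0)%E.
  by apply: (le_trans upper); rewrite lee_fin mulr0 sub0r oppr_le0.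
have mg2e : measurable_fun setT (EFin \o g2) by exact/measurable_EFinP.
have g20e z : (0 <= (EFin \o g2) z)%E by rewrite lee_fin.
rewrite (fubini_tonelli1 _ mg2e g20e) => upper.
pose D := N%:R * (B + (`|e| + 1)).
have D0 : 0 < D by rewrite mulr_gt0 ?ltr0n// addr_gt0// ltr_wpDl.
have muE : mu E = (2 ^+ N)%:E by rewrite /E rV_lebesgue_ball// mulr1.
pose kap := 2 ^+ N / D `^ q; have kap0 : 0 < kap.
  by rewrite divr_gt0 ?exprn_gt0 ?powR_gt0.
have zero : (\int[mu]_x `|(phi x `^ p * kap)%:E| = 0)%E.
  apply/eqP; rewrite eq_le; apply/andP; split; last exact: integral_ge0.
  apply: le_trans upper; apply: ge0_le_integral => //.
  - apply: (measurableT_comp (@abse_measurable _ _)); apply/measurable_EFinP.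
    exact: measurable_funM.
  - exact: measurable_fun_fubini_tonelli_F.
  move=> x _; rewrite gee0_abs; last by rewrite lee_fin pmulr_lge0 ?powR_ge0.
  rewrite /fubini_F /=; have [Ox|Ox] := pselect (Omega x); last first.
    by rewrite phi_out// powR0 ?gt_eqF// mul0r integral_ge0// => y _; rewrite lee_fin.
  under eq_integral do rewrite /g2 /= EFinM.
  rewrite ge0_integralZl_EFin ?powR_ge0//; last 2 first.
  - by move=> y _; rewrite lee_fin.
  - by apply/measurable_EFinP; exact: (measurableT_comp mker (measurable_pair1 x)).
  rewrite EFinM lee_wpmul2l ?lee_fin ?powR_ge0//.
  apply: (@le_trans _ _ (\int[mu]_y ((D `^ q)^-1%:E * (\1_E y)%:E))%E).
    have Dq0 : 0 <= (D `^ q)^-1 by rewrite invr_ge0 powR_ge0.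
    rewrite (@ge0_integralZl_EFin _ _ _ mu _ measurableT (fun y => (\1_E y)%:E))//.
      by rewrite integral_indic// setIT [X in (_ * X)%E]muE -EFinM mulrC.
    by apply/measurable_EFinP; exact: measurable_indic.
  apply: ge0_le_integral => //.
  - by move=> y _; rewrite -EFinM lee_fin mulr_ge0 ?invr_ge0 ?powR_ge0.
  - by apply: measurable_funeM; apply/measurable_EFinP; exact: measurable_indic.
  - by apply/measurable_EFinP; exact: (measurableT_comp mker (measurable_pair1 x)).
  move=> y _; rewrite -EFinM lee_fin /ker /= mulrC indicE.
  have [Ey|nEy] := pselect (E y); last by rewrite memNset// !mul0r.
  rewrite mem_set// !mul1r.
  have xy : x - y != 0.
    by rewrite subr_eq0; apply/eqP => xy; apply: (EO y Ey); rewrite -xy.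
  rewrite lef_pV2 ?posrE ?powR_gt0 ?enorm_gt0//.
  rewrite ge0_ler_powR ?nnegrE ?enorm_ge0 ?(ltW q0) ?(ltW D0)//.
  apply: (le_trans (enorm_le_norm _)); rewrite ler_wpM2l// (le_trans (ler_normB _ _))//.
  apply: lerD; first exact/ltW/OB.
  rewrite -[y](subKr e) (le_trans (ler_normB _ _))// lerD2l.
  by move: Ey; rewrite /E rV_ballE => /ltW.
have mphik : measurable_fun setT (fun x => (phi x `^ p * kap)%:E).
  by apply/measurable_EFinP; exact: measurable_funM.
have phi_ae0 := (ae_eq_integral_abs mu measurableT mphik).1 zero.
apply: filterS2 u_ext phi_ae0 => x ux /(_ I) [/eqP].
rewrite mulf_eq0 (gt_eqF kap0) orbF powR_eq0 => /andP[/eqP phix _].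
have [Ox|Ox] := pselect (Omega x); last exact: ux.
have : - w x <= phi x by rewrite /phi le_max lexx orbT.
by rewrite phix w_in// oppr_le0.
Qed.

(** Around a point of [Omega'] the positive part of [u] satisfies the level set
    estimate. If [u] had mass somewhere, the iteration would prevent [u] from being
    uniformly small near that point, contrary to continuity where [u <= 0]. *)
Lemma strong_minimum_principle Omega' :
  {within closure Omega, continuous c} ->
  open Omega' -> Omega' `<=` Omega ->
  weak_supersol_bounded s p Omega' (pairing Omega f) u ->
  {ae mu, forall x, 0 <= u x} ->
  (exists2 x, Omega' x & u x <= 0) -> {ae mu, forall x, u x = 0}.
Proof.
move=> c_cont oO' OO' [_ _ super] u_ae0 [x0 Ox0 ux0].
have p1 := p_gt1; have p0 : 0 < p by lra.
have u_ge0 := ae_ge0_continuous Omega_open u_cont u_ae0.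
pose w x := Num.max (u x) 0.
have mw : measurable_fun setT w by exact: measurable_maxr.
have w0 x : 0 <= w x by rewrite le_max lexx orbT.
have uw : {ae mu, forall x, u x = w x}.
  by apply: filterS u_ae0 => x ux; rewrite /w max_l.
apply: contrapT => nz.
have nzw : ~ {ae mu, forall x, w x = 0}.
  by move=> w_ae0; apply: nz; apply: filterS2 uw w_ae0 => x ->.
have [del [S [del0 mS bS S0 Sdel]]] := mass_of_not_ae_eq0 mw w0 nzw.
have [rho /= rho0 rhoO] : exists2 rho : R, 0 < rho & ball x0 rho `<=` Omega'.
  have /nbhs_ballP[rho /= rho0 rhoO] : nbhs x0 Omega' by exact: open_nbhs_nbhs.
  by exists rho.
pose r0 := Num.min 1 (rho / 2).
have r00 : 0 < r0 by rewrite lt_min ltr01 divr_gt0.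
have r01 : r0 <= 1 by rewrite ge_min lexx.
have r0rho : r0 < rho.
  by rewrite gt_min; apply/orP; right; rewrite ltr_pdivrMr// ltr_pMr// ltr1n.
have ballO' : ball x0 r0 `<=` Omega'.
  by apply: subset_trans rhoO; apply: le_ball; exact: ltW.
have ballO : ball x0 r0 `<=` Omega by exact: subset_trans ballO' OO'.
have bounded_ball : bounded_set (ball x0 r0).
  apply: (@bounded_norm_le _ _ (`|x0| + r0)) => y; rewrite rV_ballE /= => yr.
  by rewrite -[y](subKr x0) (le_trans (ler_normB _ _))// lerD2l ltW.
have [U [oU _ BU [_ uU]]] : exists U : set 'rV[R]_N,
    [/\ open U, compact (closure (ball x0 r0)), closure (ball x0 r0) `<=` U & Wsp s p U u].
  by case: u_Wcal => _ /(_ _ bounded_ball ballO) + _; apply.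
have mU : measurable U by exact: rV_open_measurable.
pose K := [set y : 'rV[R]_N | `|x0 - y| <= r0].
have KO : K `<=` Omega.
  move=> y yr; apply/OO'/rhoO; rewrite rV_ballE /=; exact: le_lt_trans yr r0rho.
have cK : compact K.
  apply: bounded_closed_compact.
    apply: (@bounded_norm_le _ _ (`|x0| + r0)) => y yr.
    by rewrite -[y](subKr x0) (le_trans (ler_normB _ _))// lerD2l.
  apply: (@closed_comp _ _ (fun y : 'rV[R]_N => `|x0 - y|) [set x | x <= r0]).
    move=> y _; apply: continuous_comp; last exact: norm_continuous.
    by apply: continuousB; [exact: cst_continuous|exact: cvg_id].
  exact: closed_le.
have [M M0 cM] : exists2 M : R, 0 <= M & forall x, K x -> `|c x| <= M.
  apply: continuous_bounded_on => //; apply: continuous_subspaceW c_cont.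
  by move=> y /KO /subset_closure.
have mc : measurable_fun Omega c.
  apply: open_continuous_measurable => // y /set_mem Oy.
  exact: continuous_closure_open c_cont Oy.
have F_ge (k : R) (phi : 'rV[R]_N -> R) (E : set 'rV[R]_N) :
    0 < k -> measurable_fun setT phi -> measurable E -> E `<=` ball x0 r0 ->
    (forall x, E x -> w x <= k) -> (forall x, 0 <= phi x) ->
    (forall x, phi x <= k * \1_E x) ->
    - (M * k `^ p * fine (mu E)) <= pairing Omega f phi.
  move=> k0 mphi mE EB wk phi0 phik.
  apply: Rintegral_ge_of_bound => //.
  - apply: (@le_lt_trans _ _ (mu (ball x0 r0))); last by rewrite rV_lebesgue_ball// ltry.
    by apply: le_measure; rewrite ?inE//; exact: measurable_rV_ball.
  - apply: measurable_funM; last by apply: (measurable_funS measurableT).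
    apply: measurable_funM => //; apply: (measurable_funS measurableT) => //.
    exact: (measurableT_comp (measurable_spow p)).
  - by rewrite mulr_ge0 ?powR_ge0.
  move=> x Ox; have := phik x; have := phi0 x; rewrite indicE.
  have [Ex|nE] := pselect (E x); last first.
    rewrite memNset// !mulr0 => h1 h2.
    have -> : phi x = 0 by apply/eqP; rewrite eq_le h1 h2.
    by rewrite mulr0 normr0.
  rewrite mem_set// !mulr1 => phix0 phixk.
  rewrite normrM [`|c x * _|]normrM -(powR_subr1_mulr p_gt1 (ltW k0)) mulrA; apply: ler_pM => //.
    apply: ler_pM => //.
      by apply: cM; have := EB x Ex; rewrite rV_ballE => /ltW.
    rewrite (spow_ge0E p_gt1) ?u_ge0// ger0_norm ?powR_ge0//.
    rewrite ge0_ler_powR ?nnegrE ?u_ge0 ?(ltW k0)//; first by lra.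
    by apply: le_trans (wk x Ex); rewrite le_max lexx.
  by rewrite ger0_norm.
have [C C0 growth] : exists2 C : R, 0 < C & level_set_growth w x0 s p r0 C.
  have ballU : ball x0 r0 `<=` U by move=> y By; apply: BU; exact: subset_closure.
  have wU : (gagliardo s p U w < +oo)%E by rewrite -(@gagliardo_ae _ _ s p U u w).
  have w_super phi : Wtilde s p Omega' phi -> (forall x, 0 <= phi x) ->
      ((pairing Omega f phi)%:E <= fracplap_form s p w phi)%E.
    move=> Wphi phi0; rewrite -(@fracplap_form_ae _ _ s p u w phi)//.
      by apply: super => //; exact: aeW.
    exact: Wtilde_measurable Wphi.
  exact: (sublevel_growth s_gt0 s_lt1 p_gt1 r01 mw w0 M0 mU
    (rV_open_measurable oO') ballU ballO' wU w_super F_ge).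
have [k k0] := sublevel_not_nbhs N_gt0 s_gt0 s_lt1 p_gt1 r00 mw C0 growth
  del0 mS bS S0 Sdel.
have := continuous_closure_open Omega_open u_cont (OO' _ Ox0).
move=> /(cvgr_lt (u x0)) /(_ k (le_lt_trans ux0 k0)).
move=> /nbhs_ballP[tau /= tau0 utau] /(_ tau tau0); apply.
by move=> y /utau /= uy; rewrite /w gt_max uy.
Qed.

End minimum_principle.

Theorem theorem1p4 (R : realType) (N : nat) (N_gt0 : (0 < N)%N) (s p : R)
  (s_gt0 : 0 < s) (s_lt1 : s < 1) (p_gt1 : 1 < p)
  (Omega : set 'rV[R]_N) (Omega_open : open Omega)
  (c : 'rV[R]_N -> R) (c_cont : {within closure Omega, continuous c})
  (c_le0 : forall x, closure Omega x -> c x <= 0)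
  (u : 'rV[R]_N -> R) (u_Wcal : Wcal s p Omega u)
  (u_cont : {within closure Omega, continuous u})
  (u_super : weak_supersol_eq s p Omega c u) :
  (bounded_set Omega ->
   {ae rV_lebesgue R N, forall x, (~` Omega) x -> 0 <= u x} ->
   (forall x, Omega x -> 0 < u x) \/ {ae rV_lebesgue R N, forall x, u x = 0})
  /\
  ({ae rV_lebesgue R N, forall x, 0 <= u x} ->
   (forall x, Omega x -> 0 < u x) \/ {ae rV_lebesgue R N, forall x, u x = 0}).
Proof.
have c_le0' x : Omega x -> c x <= 0 by move=> Ox; apply/c_le0/subset_closure.
case: u_super => _ _ [_ _ super_b super_u].
have strong : {ae rV_lebesgue R N, forall x, 0 <= u x} ->
    (forall x, Omega x -> 0 < u x) \/ {ae rV_lebesgue R N, forall x, u x = 0}.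
  move=> u0; have [pos|] := pselect (forall x, Omega x -> 0 < u x); first by left.
  move=> /existsNP[x /not_implyP[Ox /negP]]; rewrite -leNgt => ux; right.
  have [bO|uO] := pselect (bounded_set Omega).
    apply: (strong_minimum_principle N_gt0 s_gt0 s_lt1 p_gt1 Omega_open u_cont u_Wcal
      c_cont Omega_open _ (super_b bO) u0) => //.
    by exists x.
  have /nbhs_ballP[r /= r0 xrO] : nbhs x Omega by exact: open_nbhs_nbhs.
  have bounded_ball : bounded_set (ball x r).
    apply: (@bounded_norm_le _ _ (`|x| + r)) => y; rewrite rV_ballE /= => yr.
    by rewrite -[y](subKr x) (le_trans (ler_normB _ _))// lerD2l ltW.
  have oB : open (ball x r) by exact: ball_open.
  apply: (strong_minimum_principle N_gt0 s_gt0 s_lt1 p_gt1 Omega_open u_cont u_Wcal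
    c_cont oB xrO (super_u uO _ oB bounded_ball xrO) u0).
  by exists x => //; exact: ballxx.
split=> // bO u_ext; apply: strong.
exact: (weak_minimum_principle N_gt0 s_gt0 s_lt1 p_gt1 Omega_open c_le0' u_cont u_Wcal
  bO (super_b bO) u_ext).
Qed.
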